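(* Let $m\ge1$ and $k\ge1$ be integers, let $(t_i)_{i\in\mathbb Z}$ be a strictly increasing sequence of real numbers, let $(m_i)_{i\in\mathbb Z}$ be integers with $1\le m_i\le m$, and let $\mathcal V_m$ be the associated real spline space. A sequence $E\subset[t_0,t_k]$ consisting of (finitely many) distinct points is a phaseless sampling sequence for $\mathcal V_m|_{[t_0,t_k]}$ if and only if all of the following hold: \begin{align*} \# E &\ge 2m+1+\sum_{l=1}^{k-1}2m_l,\\ \#(E\cap[t_0,t_n)) &\ge m+m_n+\sum_{l=1}^{n-1}2m_l,\qquad 1\le n\le k,\\ \#(E\cap(t_n,t_k]) &\ge m+m_n+\sum_{l=n+1}^{k-1}2m_l,\qquad 0\le n\le k-1,\\ \#(E\cap(t_{n_1},t_{n_2})) &\ge m_{n_1}+m_{n_2}-1+\sum_{l=n_1+1}^{n_2-1}2m_l,\qquad 0\le n_1<n_2\le k. \end{align*}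
   Context: Empty sums are $0$; $\#$ denotes cardinality. Spline space. Let $m\ge1$, $(t_i)_{i\in\mathbb Z}$ real with $t_i<t_{i+1}$, and $(m_i)_{i\in\mathbb Z}$ integers with $1\le m_i\le m$. The B-spline of degree $m$ with knots $y_0\le\cdots\le y_{m+1}$ (repeated according to multiplicity) is $x\mapsto[y_0,\dots,y_{m+1}](\cdot-x)_+^m$, the divided difference in the variable $y$ of $(y-x)_+^m$ (the normalization by a positive constant is irrelevant). For $i\in\mathbb Z$ and $1\le l\le m_i$, $Q_{i,l}$ is the degree-$m$ B-spline with $m+2$ knots $(t_i,\dots,t_i,t_{i+1},\dots,t_{i+n})$, where $t_i$ appears $l$ times, $t_j$ appears $m_j$ times for $i+1\le j\le i+n-1$, and $t_{i+n}$ appears $m+2-(l+m_{i+1}+\cdots+m_{i+n-1})$ times; here $n\ge1$ is the unique integer for which this last number is between $1$ and $m_{i+n}$. Set $$\mathcal V_m=\Big\{\sum_{i\in\mathbb Z}\sum_{1\le l\le m_i}c_{i,l}Q_{i,l}:\ c_{i,l}\in\mathbb R\Big\}$$ (a locally finite sum), and let $\mathcal V_m|_{[a,b]}$ be the set of restrictions of its elements to $[a,b]$. Separability. A function $f$ in a set $H$ of functions is separable (in $H$) if $f=f_1+f_2$ for some $f_1,f_2\in H\setminus\{0\}$ with $f_1(x)f_2(x)=0$ for all $x$; otherwise it is nonseparable. Here $H=\mathcal V_m|_{[t_0,t_k]}$. Phaseless sampling sequence. $E=\{x_n:1\le n\le N\}\subset[a,b]$ is a phaseless sampling sequence for $H=\mathcal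 V_m|_{[a,b]}$ if every nonseparable $f\in H$ is determined up to a phase (a sign, since functions are real) by its phaseless samples on $E$: whenever $f\in H$ is nonseparable, $g\in H$ and $|f(x_n)|=|g(x_n)|$ for all $n$, then $g=f$ or $g=-f$ on $[a,b]$. *)

(* Defs.v *)
From HB Require Import structures.
From mathcomp Require Import all_boot all_order all_algebra.
From mathcomp Require Import all_classical all_reals all_analysis.

Set Implicit Arguments.
Unset Strict Implicit.
Unset Printing Implicit Defensive.

Import Order.TTheory GRing.Theory Num.Theory.
Import numFieldNormedType.Exports.

Local Open Scope classical_set_scope.
Local Open Scope ring_scope.

Section Splines.
Context {R : realType}.

(* [y_i, ..., y_(i+r)]f for nondecreasing y, with coincident points allowed:
   the confluent value f^(r)(y_i) / r! when y_i = ... = y_(i+r), and the usual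
   quotient of differences otherwise. *)
Fixpoint divided_difference (f : R -> R) (y : nat -> R) (i r : nat) : R :=
  if r is r'.+1 then
    if y i == y (i + r)%N then derive1n r f (y i) / r`!%:R
    else (divided_difference f y i.+1 r' - divided_difference f y i r')
         / (y (i + r)%N - y i)
  else f (y i).

Definition truncated_power (m : nat) (x y : R) : R := Num.max (y - x) 0 ^+ m.

Definition bspline (m : nat) (y : nat -> R) (x : R) : R :=
  divided_difference (truncated_power m x) y 0 m.+1.

Variables (m : nat) (t : int -> R) (mu : int -> nat).

Definition last_mult (i : int) (l n : nat) : nat :=
  (m + 2 - (l + \sum_(1 <= j < n) mu (i + j%:Z)%R))%N.

(* Since every multiplicity is positive and l <= m, exactly one n qualifies
   and the default value 1 is never used. *)
Definition knot_span (i : int) (l : nat) : nat :=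
  xget 1%N [set n | (1 <= n)%N /\ (1 <= last_mult i l n <= mu (i + n%:Z)%R)%N].

Definition knots (i : int) (l : nat) : seq R :=
  let n := knot_span i l in
  nseq l (t i)
  ++ flatten [seq nseq (mu (i + j%:Z)) (t (i + j%:Z)) | j <- index_iota 1 n]
  ++ nseq (last_mult i l n) (t (i + n%:Z)).

Definition Q (i : int) (l : nat) : R -> R := bspline m (nth 0 (knots i l)).

(* At any x only finitely many terms are nonzero, because Q i l vanishes
   outside [t_i, t_(i+m+1)]; \sum_(i \in _) is the finite-support sum. *)
Definition spline_space : set (R -> R) :=
  [set f | exists c : int -> nat -> R, forall x,
     f x = \sum_(i \in [set: int]) \sum_(1 <= l < (mu i).+1) c i l * Q i l x].

Definition spline_space_on (a b : R) : set (`[a, b]%classic -> R) :=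
  sigL `[a, b] @` spline_space.

End Splines.

Arguments spline_space_on {R} m t mu a b _.

Section Phaseless.
Context {R : realType}.

Definition separable (X : Type) (H : set (X -> R)) (f : X -> R) : Prop :=
  exists f1 f2 : X -> R,
    [/\ H f1 /\ f1 <> cst 0, H f2 /\ f2 <> cst 0,
        (forall x, f x = f1 x + f2 x) & (forall x, f1 x * f2 x = 0)].

Definition nonseparable (X : Type) (H : set (X -> R)) (f : X -> R) : Prop :=
  ~ separable H f.

Definition phaseless_sampling_sequence (A : set R) (H : set (A -> R))
    (E : seq R) : Prop :=
  (forall x, x \in E -> A x) /\
  forall f g : A -> R, H f -> nonseparable H f -> H g ->
    (forall x : A, set_val x \in E -> `|f x| = `|g x|) ->
    (forall x, g x = f x) \/ (forall x, g x = - f x).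

End Phaseless.

(* Main.v *)
Require Import Defs.
From HB Require Import structures.
From mathcomp Require Import all_boot all_order all_algebra.
From mathcomp Require Import all_classical all_reals all_analysis.
From mathcomp Require Import polyorder polyrcf.
From mathcomp Require Import ring lra zify.

Set Implicit Arguments.
Unset Strict Implicit.
Unset Printing Implicit Defensive.

Import Order.TTheory GRing.Theory Num.Theory.
Import numFieldNormedType.Exports.

Local Open Scope classical_set_scope.
Local Open Scope ring_scope.

(** The idea. If |f| = |g| on E, put u = f + g and v = f - g: then u v = 0 on E,
    and g = f or g = - f means that v = 0 or u = 0. If u and v are nonzero but
    u v vanishes identically, then 2 f = u + v shows that f is separable. So the
    question is when u v = 0 on E forces u v = 0 everywhere, and the answer is
    obtained by counting zeros of splines.

    Zeros. A spline that vanishes on no piece between the knots T a and T b has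
    there at most m + sum_(a < l < b) rho l zeros, where rho l is the multiplicity
    of T l, and fewer if it vanishes to some order at T a or T b (zero_count).
    This follows from the Budan-Fourier theorem on each piece (budan_fourier): the
    number of sign changes in p, p', p'', ... drops by one at each zero of p, and
    crossing a knot T l can raise it by at most rho l (right_changes_knot).

    One condition instead of four. Move the two end knots slightly outwards and
    give them multiplicity m + 1, that is, no smoothness condition. The four
    inequalities together then say that each open interval between two knots T a,
    T b contains at least rho a + rho b - 1 + sum_(a < l < b) 2 rho l points of E
    (sampling_conditionsP).

    Sufficiency (enough_samples_product0). If u and v were both nonzero on some
    piece, take a maximal block of such pieces. At each end of the block one of
    them vanishes on the other side of the knot, hence vanishes at the knot as far
    as the smoothness there demands. The two zero counts then add up to less than
    the number of points of E in the block.

    Necessity (gap_witness). In a shortest interval (T a, T b) with too few points,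
    minimality determines the number of points of E in each cell between
    consecutive knots, and excludes the knots. Give rho (c + 1) of the points of
    the cell (T c, T (c + 1)) to u, one less in the last cell, and the others to v.
    Starting from zero on the right of T b, extend u cell by cell to the left by
    Lagrange interpolation; extend v to the right from T a in the same way. The
    zero count shows that no knot left of T b, respectively right of T a, is one
    where u, respectively v, could be cut off. Since a < b, a generic combination
    u + c v cannot be cut at any knot, so it is nonseparable
    (contact_free_nonseparable), although u v = 0 on E with u and v nonzero.

    B-splines. All this concerns piecewise polynomials. They are the same as the
    combinations of B-splines on the interval. A divided difference is a
    combination of values and derivatives at its knots, so that each B-spline is
    a spline (in_spline_space_piecewise). Conversely the derivative of highest
    order at the last knot enters with a nonzero weight (divided_difference_top);
    as each knot, counted with multiplicity, is the last one of some B-spline, the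
    truncated powers are reached one after the other from the left
    (in_spline_space_knot_function), starting with those that vanish on the
    interval. Those of knots beyond the right end are polynomials there, and span
    all of them (polynomials_of_powers). *)

(** * Sign changes of the derivatives of a polynomial *)

Section SignChanges.
Context {R : rcfType}.
Implicit Types (p q : {poly R}) (s : seq R) (x y z : R).

Lemma mulrr_lt0F x : (x * x < 0) = false.
Proof. by rewrite -expr2 ltNge sqr_ge0. Qed.

Lemma mulNrr_lt0 x : (- x * x < 0) = (x != 0).
Proof. by rewrite mulNr oppr_lt0 -expr2 lt_neqAle sqr_ge0 andbT eq_sym sqrf_eq0. Qed.

(** If s lists p(x), p'(x), p''(x), ..., this is the sign of p immediately to the
    right of x: it is decided by the first derivative that does not vanish. *)
Fixpoint right_sign s : R :=
  if s is x :: s' then (if x == 0 then right_sign s' else Num.sg x) else 0.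

(** The sign immediately to the left of x; there p and p' have opposite signs
    when p(x) = 0. *)
Fixpoint left_sign s : R :=
  if s is x :: s' then (if x == 0 then - left_sign s' else Num.sg x) else 0.

(** The sign changes in p, p', p'', ... read at a point immediately to the right of
    x; left_changes reads them immediately to the left. *)
Fixpoint right_changes s : nat :=
  if s is x :: s' then
    ((right_sign s * right_sign s' < 0)%R + right_changes s')%N
  else 0%N.

Fixpoint left_changes s : nat :=
  if s is x :: s' then
    ((left_sign s * left_sign s' < 0)%R + left_changes s')%N
  else 0%N.

Fixpoint jet n p x : seq R :=
  if n is n'.+1 then p.[x] :: jet n' p^`() x else [::].

Lemma size_jet n p x : size (jet n p x) = n.
Proof. by elim: n p => //= n IHn p; rewrite IHn. Qed.

Lemma right_changes_lt s : (0 < size s)%N -> (right_changes s < size s)%N.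
Proof.
elim: s => // x [|y s] IHs _; first by rewrite /= mulr0 ltxx.
have := IHs isT; rewrite [right_changes (x :: _)]/= -/(right_changes (y :: s)).
rewrite -/(right_sign (y :: s)) => H.
set b := (_ < 0); set c := (c in (_ + c)%N).
have -> : c = right_changes (y :: s) by [].
move: (right_changes (y :: s)) H => w; move: b => [] /=; lia.
Qed.

Lemma poly_deriv0_root p x : p^`() = 0 -> root p x -> p = 0.
Proof.
move=> dp0 rpx; have : (size p <= 1)%N.
  by have := size_deriv p; rewrite dp0 size_poly0; case: (size p) => // [[]].
by move=> /size1_polyC pE; move: rpx; rewrite pE rootC => /eqP ->.
Qed.

Lemma size_deriv_leq n p : (size p <= n.+1)%N -> (size p^`() <= n)%N.
Proof. by rewrite size_deriv; case: (size p). Qed.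

(** When p(x) = 0, the mean value theorem transfers the sign of p' to p. *)
Lemma right_sign_near n p x : (size p <= n)%N -> p != 0 ->
  right_sign (jet n p x) != 0 /\
  exists2 y, x < y & forall z, x < z < y -> Num.sg p.[z] = right_sign (jet n p x).
Proof.
elim: n p => [|n IHn] p sp p0; first by rewrite -size_poly_gt0 in p0; lia.
rewrite /=; case: ifP => [px0|/negbT px0]; last first.
  split; first by rewrite sgr_eq0.
  have npx : 0 < `|p.[x]| by rewrite normr_gt0.
  have [d d0 Hd] := poly_cont x p npx.
  exists (x + d) => [|z /andP[xz zd]]; first by rewrite ltrDl.
  have /Hd : `|z - x| < d by rewrite ger0_norm; lra.
  case: (ltgtP p.[x] 0) px0 => // h _; rewrite ?(ltr0_norm h) ?(gtr0_norm h).
    rewrite ltr_norml => /andP[_ H]; rewrite !ltr0_sg //; lra.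
  rewrite ltr_norml => /andP[H _]; rewrite !gtr0_sg //; lra.
have rpx : root p x by [].
have [dp0|dp0] := eqVneq p^`() 0; first by rewrite (poly_deriv0_root dp0 rpx) eqxx in p0.
have sdp := size_deriv_leq sp.
have [s0 [y xy Hy]] := IHn _ sdp dp0; split => //.
exists y => // z /andP[xz zy]; have [c cxz] := mvt p xz.
rewrite (eqP px0) subr0 => ->; rewrite sgrM (gtr0_sg (x := z - x)) ?subr_gt0 // mulr1.
by move: cxz; rewrite in_itv /= => /andP[? ?]; apply: Hy; apply/andP; split; lra.
Qed.

Lemma left_sign_near n p x : (size p <= n)%N -> p != 0 ->
  left_sign (jet n p x) != 0 /\
  exists2 y, y < x & forall z, y < z < x -> Num.sg p.[z] = left_sign (jet n p x).
Proof.
elim: n p => [|n IHn] p sp p0; first by rewrite -size_poly_gt0 in p0; lia.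
rewrite /=; case: ifP => [px0|/negbT px0]; last first.
  split; first by rewrite sgr_eq0.
  have npx : 0 < `|p.[x]| by rewrite normr_gt0.
  have [d d0 Hd] := poly_cont x p npx.
  exists (x - d) => [|z /andP[xz zd]]; first by rewrite ltrBlDr ltrDl.
  have /Hd : `|z - x| < d by rewrite ler0_norm; lra.
  case: (ltgtP p.[x] 0) px0 => // h _; rewrite ?(ltr0_norm h) ?(gtr0_norm h).
    rewrite ltr_norml => /andP[_ H]; rewrite !ltr0_sg //; lra.
  rewrite ltr_norml => /andP[H _]; rewrite !gtr0_sg //; lra.
have rpx : root p x by [].
have [dp0|dp0] := eqVneq p^`() 0; first by rewrite (poly_deriv0_root dp0 rpx) eqxx in p0.
have sdp := size_deriv_leq sp.
have [s0 [y xy Hy]] := IHn _ sdp dp0; split => //; first by rewrite oppr_eq0.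
exists y => // z /andP[yz zx]; have [c cxz] := mvt p zx.
rewrite (eqP px0) sub0r => H; have -> : p.[z] = - (p^`().[c] * (x - z)) by lra.
rewrite sgrN sgrM (gtr0_sg (x := x - z)) ?subr_gt0 // mulr1; congr (- _).
by move: cxz; rewrite in_itv /= => /andP[? ?]; apply: Hy; apply/andP; split; lra.
Qed.

Lemma jet0_left n x :
  left_sign (jet n 0 x) = 0 /\ left_changes (jet n 0 x) = 0%N.
Proof.
by elim: n => //= n [lE cE]; rewrite deriv0 horner0 eqxx lE cE oppr0 mulr0 ltxx.
Qed.

Lemma right_sign_points n p x b : (size p <= n.+1)%N -> p != 0 -> p^`() != 0 ->
  x < b -> exists y, [/\ x < y < b, Num.sg p.[y] = right_sign (jet n.+1 p x)
    & Num.sg p^`().[y] = right_sign (jet n p^`() x)].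
Proof.
move=> sp p0 dp0 xb; have [_ [y xy Hy]] := right_sign_near x sp p0.
have [_ [y' xy' Hy']] := right_sign_near x (size_deriv_leq sp) dp0.
exists ((x + Num.min b (Num.min y y')) / 2).
have h : [/\ x < Num.min b (Num.min y y'), Num.min b (Num.min y y') <= b,
    Num.min b (Num.min y y') <= y & Num.min b (Num.min y y') <= y'].
  by rewrite !lt_min xb xy xy' !ge_min !lexx ?orbT.
case: h; move: (Num.min b _) => w xw wb wy wy'.
by split; [| apply: Hy | apply: Hy']; apply/andP; split; lra.
Qed.

Lemma left_sign_points n p x b : (size p <= n.+1)%N -> p != 0 -> p^`() != 0 ->
  b < x -> exists y, [/\ b < y < x, Num.sg p.[y] = left_sign (jet n.+1 p x)
    & Num.sg p^`().[y] = left_sign (jet n p^`() x)].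
Proof.
move=> sp p0 dp0 bx; have [_ [y xy Hy]] := left_sign_near x sp p0.
have [_ [y' xy' Hy']] := left_sign_near x (size_deriv_leq sp) dp0.
exists ((x + Num.max b (Num.max y y')) / 2).
have h : [/\ Num.max b (Num.max y y') < x, b <= Num.max b (Num.max y y'),
    y <= Num.max b (Num.max y y') & y' <= Num.max b (Num.max y y')].
  by rewrite !gt_max bx xy xy' !le_max !lexx ?orbT.
case: h; move: (Num.max b _) => w xw wb wy wy'.
by split; [| apply: Hy | apply: Hy']; apply/andP; split; lra.
Qed.

Definition roots_between p a b zs :=
  [/\ path <%R a zs, all (< b) zs & all (root p) zs].

(** p grows away from its zero a and is on its way back to zero at b, so it has
    turned in between. *)
Lemma deriv_root_right p a b : a < b -> root p a -> p.[b] * p^`().[b] < 0 ->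
  exists2 c, a < c < b & root p^`() c.
Proof.
move=> ab /eqP pa0 H; have [c cab] := mvt p ab; rewrite pa0 subr0 => pbE.
move: cab; rewrite in_itv /= => /andP[ac cb].
have H2 : p^`().[c] * p^`().[b] < 0.
  have ba0 : 0 < b - a by rewrite subr_gt0.
  by move: H; rewrite pbE mulrAC pmulr_llt0.
have [d] := poly_ivtoo (ltW cb) H2; rewrite in_itv /= => /andP[cd db] rd.
by exists d => //; rewrite db (lt_trans ac).
Qed.

Lemma deriv_root_left p a b : a < b -> root p b -> 0 < p.[a] * p^`().[a] ->
  exists2 c, a < c < b & root p^`() c.
Proof.
move=> ab /eqP pb0 H; have [c cab] := mvt p ab; rewrite pb0 sub0r => paE.
move: cab; rewrite in_itv /= => /andP[ac cb].
have H2 : p^`().[a] * p^`().[c] < 0.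
  have ba0 : 0 < b - a by rewrite subr_gt0.
  move: H; have -> : p.[a] = - (p^`().[c] * (b - a)) by rewrite -paE opprK.
  by rewrite mulNr oppr_gt0 mulrAC pmulr_llt0 // mulrC.
have [d] := poly_ivtoo (ltW ac) H2; rewrite in_itv /= => /andP[cd db] rd.
by exists d => //; rewrite cd (lt_trans db).
Qed.

(** Besides the zeros of p' that Rolle's theorem puts between consecutive zeros of
    p, there is one after the last zero if |p| decreases just before b. *)
Lemma deriv_roots_tail n p b z zs : (size p <= n.+1)%N -> p != 0 -> p^`() != 0 ->
  z < b -> root p z -> roots_between p z b zs ->
  exists2 ws, roots_between p^`() z b ws &
    size ws = (size zs
      + (left_sign (jet n.+1 p b) * left_sign (jet n p^`() b) < 0)%R)%N.
Proof.
move=> sp p0 dp0; elim: zs z => [|z' zs IHzs] z zb rz.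
  move=> _; case: ltP => H; last by exists [::].
  have [y [/andP[zy yb] s1 s2]] := left_sign_points sp p0 dp0 zb.
  have [|c /andP[zc cy] rc] := deriv_root_right zy rz.
    by rewrite -sgr_lt0 sgrM s1 s2.
  by exists [:: c] => //; split; rewrite /= ?zc ?rc ?(lt_trans cy yb).
case=> /= /andP[zz' pzs] /andP[z'b azs] /andP[rz' rzs].
have [|ws [pws aws rws] sws] := IHzs z' z'b rz'; first by split.
have [|c] := rolle zz' (p := p); first by rewrite (eqP rz) (eqP rz').
rewrite in_itv /= => /andP[zc cz'] rc; exists (c :: ws); last by rewrite /= sws addSn.
split=> /=.
- rewrite zc /=; case: ws pws {aws rws sws} => //= w ws /andP[zw ->].
  by rewrite (lt_trans cz').
- by rewrite aws (lt_trans cz').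
- by rewrite rws andbT; apply/eqP.
Qed.

(** Passing from p to p' loses at most one zero. None is lost if |p| increases just
    after a, and one is gained if moreover |p| decreases just before b. These two
    events are what the sign changes between p and p' record. *)
Lemma deriv_roots n p a b zs : (size p <= n.+1)%N -> p != 0 -> p^`() != 0 ->
  a < b -> roots_between p a b zs ->
  exists2 ws, roots_between p^`() a b ws &
    (size zs + (left_sign (jet n.+1 p b) * left_sign (jet n p^`() b) < 0)%R
     <= size ws + (right_sign (jet n.+1 p a) * right_sign (jet n p^`() a) < 0)%R)%N.
Proof.
move=> sp p0 dp0 ab; have dsp := size_deriv_leq sp.
have [rp0 _] := right_sign_near a sp p0.
have [rdp0 _] := right_sign_near a dsp dp0.
have same : (right_sign (jet n.+1 p a) * right_sign (jet n p^`() a) < 0) = false ->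
    0 < right_sign (jet n.+1 p a) * right_sign (jet n p^`() a).
  move=> /negbT; rewrite -leNgt le_eqVlt => /orP[/eqP H|//].
  by move: (mulf_neq0 rp0 rdp0); rewrite -H eqxx.
case: zs => [|z zs].
  move=> _; case: (ltP (left_sign _ * _) 0) => [H|]; last by exists [::].
  case: (boolP (right_sign _ * _ < 0)) => [_|/negbTE/same Hr]; first by exists [::].
  have [x [/andP[ax xb] s1 s2]] := right_sign_points sp p0 dp0 ab.
  have [y [/andP[xy yb] s3 s4]] := left_sign_points sp p0 dp0 xb.
  have Hx : 0 < p.[x] * p^`().[x] by rewrite -sgr_gt0 sgrM s1 s2.
  have Hy : p.[y] * p^`().[y] < 0 by rewrite -sgr_lt0 sgrM s3 s4.
  suff [c /andP[xc cy] rc] : exists2 c, x < c < y & root p^`() c.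
    exists [:: c] => //; split=> /=; rewrite ?rc //.
    - by rewrite (lt_trans ax xc).
    - by rewrite (lt_trans cy yb).
  (* zs is any list of zeros of p, so p may change sign although zs is empty *)
  case: (ltP (p.[x] * p.[y]) 0) => Hxy.
    have [z] := poly_ivtoo (ltW xy) Hxy; rewrite in_itv /= => /andP[xz zy] rz.
    have [c /andP[zc cy] rc] := deriv_root_right zy rz Hy.
    by exists c => //; rewrite cy (lt_trans xz).
  have [|c] := @poly_ivtoo _ p^`() x y (ltW xy); last first.
    by rewrite in_itv /=; exists c.
  have Hxy' : 0 < p.[x] * p.[y].
    rewrite lt_neqAle Hxy andbT eq_sym mulf_neq0 //.
      by apply: contraTneq Hx => ->; rewrite mul0r ltxx.
    by apply: contraTneq Hy => ->; rewrite mul0r ltxx.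
  have : (p.[x] * p.[y]) * (p^`().[x] * p^`().[y]) < 0.
    by rewrite mulrACA pmulr_rlt0.
  by rewrite pmulr_rlt0.
case=> /andP[az pzs] /andP[zb azs] /andP[rz rzs].
have [|ws [pws aws rws] sws] := deriv_roots_tail sp p0 dp0 zb rz (zs := zs).
  by split.
case: (boolP (right_sign _ * _ < 0)) => [_|/negbTE/same Hr].
  exists ws; last by rewrite sws addn1 addSn.
  by split=> //; case: ws pws {aws rws sws} => //= w ws /andP[zw ->]; rewrite (lt_trans az).
have [x [/andP[ax xz] s1 s2]] := right_sign_points sp p0 dp0 az.
have [|c /andP[xc cz] rc] := deriv_root_left xz rz.
  by rewrite -sgr_gt0 sgrM s1 s2.
exists (c :: ws); last by rewrite /= sws addn0 addSn.
split=> /=; rewrite ?rc ?aws ?(lt_trans cz zb) ?(lt_trans ax xc) //=.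
by case: ws pws {aws rws sws} => //= w ws /andP[zw ->]; rewrite (lt_trans cz).
Qed.

Theorem budan_fourier n p a b zs : (size p <= n)%N -> p != 0 -> a < b ->
  roots_between p a b zs ->
  (size zs + left_changes (jet n p b) <= right_changes (jet n p a))%N.
Proof.
elim: n p zs => [|n IHn] p zs sp p0 ab Hzs.
  by move: p0; rewrite -size_poly_gt0; move: sp; case: (size p).
have [dp0|dp0] := eqVneq p^`() 0.
  case: zs Hzs => [_|z zs [_ _ /= /andP[rz _]]]; last first.
    by rewrite (poly_deriv0_root dp0 rz) eqxx in p0.
  have [l0 c0] := jet0_left n b.
  by rewrite [left_changes _]/= dp0 l0 c0 mulr0 ltxx.
have [ws Hws Hsize] := deriv_roots sp p0 dp0 ab Hzs.
have := IHn _ ws (size_deriv_leq sp) dp0 ab Hws.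
rewrite [left_changes (jet n.+1 _ _)]/= [right_changes (jet n.+1 _ _)]/=.
rewrite -[if _ then _ else _]/(left_sign (jet n.+1 p b)).
rewrite -[X in (X * right_sign _ < 0)]/(right_sign (jet n.+1 p a)).
lia.
Qed.

Lemma dvdp_exp_deriv n x p :
  ('X - x%:P) ^+ n.+1 %| p -> ('X - x%:P) ^+ n %| p^`().
Proof.
move=> /dvdpP[q ->]; rewrite derivM deriv_exp derivXsubC mul1r /=.
by rewrite dvdp_add // dvdp_mull // ?(exprS, dvdp_mull) // -mulr_natl dvdp_mull.
Qed.

Lemma dvdp_exp_root n x p : ('X - x%:P) ^+ n.+1 %| p -> root p x.
Proof. by rewrite -dvdp_XsubCl; apply: dvdp_trans; rewrite exprS dvdp_mulr. Qed.

(** The e leading zeros are skipped when reading signs on the right. *)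
Lemma right_changes_vanish e n p x : (size p <= n)%N -> p != 0 ->
  ('X - x%:P) ^+ e %| p -> (right_changes (jet n p x) + e < n)%N.
Proof.
elim: e n p => [|e IHe] [|n] p sp p0 dvd.
- by move: p0; rewrite -size_poly_gt0; case: (size p) sp.
- by rewrite addn0 -[X in (_ < X)%N](size_jet n.+1 p x) right_changes_lt ?size_jet.
- by move: p0; rewrite -size_poly_gt0; case: (size p) sp.
have rp := dvdp_exp_root dvd.
have dp0 : p^`() != 0 by apply: contra_neq p0 => dp; apply: poly_deriv0_root dp rp.
have := IHe _ _ (size_deriv_leq sp) dp0 (dvdp_exp_deriv dvd).
rewrite [right_changes (jet n.+1 _ _)]/= (eqP rp) eqxx.
rewrite mulrr_lt0F; lia.
Qed.

(** On the left, each of the e leading zeros produces a sign change. *)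
Lemma left_changes_vanish e n p x : (size p <= n)%N -> p != 0 ->
  ('X - x%:P) ^+ e %| p -> (e <= left_changes (jet n p x))%N.
Proof.
elim: e n p => // e IHe [|n] p sp p0 dvd.
  by move: p0; rewrite -size_poly_gt0; case: (size p) sp.
have rp := dvdp_exp_root dvd.
have dp0 : p^`() != 0 by apply: contra_neq p0 => dp; apply: poly_deriv0_root dp rp.
have := IHe _ _ (size_deriv_leq sp) dp0 (dvdp_exp_deriv dvd).
have [u0 _] := left_sign_near x (size_deriv_leq sp) dp0.
rewrite [left_changes (jet n.+1 _ _)]/= (eqP rp) eqxx.
rewrite mulNrr_lt0 u0; lia.
Qed.

(** The derivatives of order below e agree at x and contribute equally to both
    sides once the signs agree; the n - e others contribute at most n - e - 1 on
    the left-hand side, and the unit so gained pays for a first disagreement of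
    the signs. This is why the bound carries the extra term. *)
Lemma right_changes_knot_aux e n p q x : (e < n)%N -> ('X - x%:P) ^+ e %| q - p ->
  (right_changes (jet n q x) + (right_sign (jet n q x) != left_sign (jet n p x))
   <= left_changes (jet n p x) + (n - e))%N.
Proof.
elim: e n p q => [|e IHe] [|n] p q // en dvd.
  have := @right_changes_lt (jet n.+1 q x); rewrite size_jet subn0 => /(_ isT).
  by case: (_ != _); lia.
have /eqP qpx := dvdp_exp_root dvd; rewrite hornerD hornerN in qpx.
have {}qpx : q.[x] = p.[x] by apply/eqP; rewrite -subr_eq0 qpx.
have := IHe n p^`() q^`() en; rewrite -derivB => /(_ (dvdp_exp_deriv dvd)).
rewrite [right_changes (jet n.+1 _ _)]/= [left_changes (jet n.+1 _ _)]/=.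
rewrite [right_sign (jet n.+1 _ _)]/= [left_sign (jet n.+1 _ _)]/= qpx subSS.
move: (right_changes _) (left_changes _) (n - e)%N => A B w.
move: (right_sign (jet n q^`() x)) (left_sign (jet n p^`() x)) => u v.
case: ifP => _; last first.
  rewrite eqxx; have [->|_] := eqVneq u v => /=; first lia.
  by case: (_ * u < 0); case: (_ * v < 0); lia.
rewrite mulrr_lt0F mulNrr_lt0.
have [->|_] := eqVneq v 0; first by rewrite oppr0; case: (u != 0) => /=; lia.
by case: (u != v); case: (u != - v); lia.
Qed.

(** A zero at the knot itself is paid for by the sign change that it forces on
    its left. *)
Lemma right_changes_knot e n p q x : (size p <= n)%N -> p != 0 -> (0 < e < n)%N ->
  ('X - x%:P) ^+ e %| q - p ->
  (root p x + right_changes (jet n q x) <= left_changes (jet n p x) + (n - e))%N.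
Proof.
move=> sp p0 /andP[e0 en] dvd; have [rp|_] := boolP (root p x); last first.
  by have := right_changes_knot_aux en dvd; case: (_ != _); lia.
case: n e sp e0 en dvd => [|n] [|e] // sp _ en dvd.
have /eqP qpx := dvdp_exp_root dvd; rewrite hornerD hornerN (eqP rp) subr0 in qpx.
have dp0 : p^`() != 0 by apply: contra_neq p0 => dp; apply: poly_deriv0_root dp rp.
have [u0 _] := left_sign_near x (size_deriv_leq sp) dp0.
have := @right_changes_knot_aux e n p^`() q^`() x en.
rewrite -derivB => /(_ (dvdp_exp_deriv dvd)).
rewrite [right_changes (jet n.+1 _ _)]/= [left_changes (jet n.+1 _ _)]/=.
rewrite qpx (eqP rp) eqxx subSS.
rewrite mulrr_lt0F mulNrr_lt0 u0.
by case: (_ != _); lia.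
Qed.

End SignChanges.

(** * Zeros of splines *)
Section ZeroCount.
Context {R : rcfType}.
Implicit Types (p q : {poly R}) (E : seq R) (x y z : R).

Definition count_in E x y : nat := count (fun w => x < w < y) E.

Lemma count_in_split E x y z : uniq E -> x < y -> y < z ->
  count_in E x z = (count_in E x y + (y \in E) + count_in E y z)%N.
Proof.
move=> uE xy yz; rewrite -(count_uniq_mem _ uE) /count_in.
elim: E {uE} => //= w E ->; set A := count _ E; set B := count _ E; set C := count _ E.
have -> : nat_of_bool (x < w < z) = ((x < w < y)%R + (w == y) + (y < w < z)%R)%N.
  by case: (ltgtP w y) => [wy|wy|->]; [rewrite (lt_trans wy yz) andbT addn0 addn0
    | rewrite (lt_trans xy wy) andbF | rewrite xy yz ?andbF].
lia.
Qed.

Lemma count_in_piece p n x y E : (size p <= n)%N -> p != 0 -> x < y -> uniq E ->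
  {in E, forall z, x <= z <= y -> root p z} ->
  (count_in E x y + left_changes (jet n p y) <= right_changes (jet n p x))%N.
Proof.
move=> sp p0 xy uE rE; set zs := sort <=%R [seq w <- E | x < w < y].
have -> : count_in E x y = size zs by rewrite size_sort size_filter.
have inzs z : z \in zs -> (x < z < y) && (z \in E) by rewrite mem_sort mem_filter.
apply: budan_fourier => //; split.
- rewrite path_sortedE; last exact: lt_trans.
  apply/andP; split; first by apply/allP => z /inzs /andP[/andP[]].
  by rewrite sort_lt_sorted filter_uniq.
- by apply/allP => z /inzs /andP[/andP[]].
- apply/allP => z /inzs /andP[/andP[xz zy] zE].
  by apply: rE => //; rewrite !ltW.
Qed.

Lemma step_lt (T : nat -> R) (a b : nat) : (a < b)%N ->
  (forall j, (a <= j < b)%N -> T j < T j.+1) -> T a < T b.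
Proof.
elim: b => // b IHb; rewrite ltnS leq_eqVlt => /orP[/eqP -> H|ab H].
  by apply: H; rewrite leqnn ltnSn.
apply: (lt_trans (IHb ab _)) => [j /andP[aj jb]|]; apply: H.
  by rewrite aj ltnW.
by rewrite (ltnW ab) ltnSn.
Qed.

Lemma count_in_pieces m (T : nat -> R) (rho : nat -> nat) (P : nat -> {poly R})
    (a b : nat) E :
  (a < b)%N -> uniq E ->
  (forall j, (a <= j < b)%N ->
     [/\ T j < T j.+1, P j != 0, (size (P j) <= m.+1)%N &
         {in E, forall z, T j <= z <= T j.+1 -> root (P j) z}]) ->
  (forall j, (a < j < b)%N -> (1 <= rho j <= m)%N /\
     ('X - (T j)%:P) ^+ (m.+1 - rho j) %| P j - P j.-1) ->
  (count_in E (T a) (T b) + left_changes (jet m.+1 (P b.-1) (T b))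
   <= right_changes (jet m.+1 (P a) (T a)) + \sum_(a.+1 <= l < b) rho l)%N.
Proof.
move=> + uE; elim: b => // b IHb; rewrite ltnS leq_eqVlt => /orP[/eqP <-|ab].
  move=> Hp _; have [|TT p0 sp rp] := Hp a; first by rewrite leqnn ltnSn.
  by rewrite big_geq // addn0 count_in_piece.
move=> Hp Hd; have [|TT p0 sp rp] := Hp b; first by rewrite (ltnW ab) ltnSn.
have wp j : (a <= j < b)%N -> (a <= j < b.+1)%N by lia.
have wd j : (a < j < b)%N -> (a < j < b.+1)%N by lia.
have IH := IHb ab (fun j H => Hp j (wp j H)) (fun j H => Hd j (wd j H)).
have [|rhob dvd] := Hd b; first by rewrite ab ltnSn.
have [|TT' p0' sp' rp'] := Hp b.-1; first lia.
rewrite prednK ?(leq_ltn_trans _ ab) // in TT' rp'.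
have Tab : T a < T b.
  by apply: step_lt ab _ => j /wp /Hp [].
have Hpiece := count_in_piece sp p0 TT uE rp.
have := @right_changes_knot _ (m.+1 - rho b)%N m.+1 _ _ _ sp' p0' _ dvd.
have -> : (m.+1 - (m.+1 - rho b) = rho b)%N by lia.
have sumE : (\sum_(a.+1 <= l < b.+1) rho l = \sum_(a.+1 <= l < b) rho l + rho b)%N.
  by rewrite big_nat_recr.
rewrite {}sumE (count_in_split uE Tab TT) -[b.+1.-1]/b => Hk.
have : (0 < m.+1 - rho b < m.+1)%N by lia.
move=> /Hk {Hk}; have : ((T b \in E) <= root (P b.-1) (T b))%N.
  by case: (boolP (_ \in E)) => //= /rp' -> //; rewrite lexx ltW.
lia.
Qed.

(** The bound is one less than the dimension of the space of splines with the given
    knots that vanish to the orders ea and eb at the ends. *)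
Theorem zero_count m (T : nat -> R) (rho : nat -> nat) (P : nat -> {poly R})
    (a b ea eb : nat) E :
  (a < b)%N -> uniq E ->
  (forall j, (a <= j < b)%N ->
     [/\ T j < T j.+1, P j != 0, (size (P j) <= m.+1)%N &
         {in E, forall z, T j <= z <= T j.+1 -> root (P j) z}]) ->
  (forall j, (a < j < b)%N -> (1 <= rho j <= m)%N /\
     ('X - (T j)%:P) ^+ (m.+1 - rho j) %| P j - P j.-1) ->
  ('X - (T a)%:P) ^+ ea %| P a -> ('X - (T b)%:P) ^+ eb %| P b.-1 ->
  (count_in E (T a) (T b) + ea + eb <= m + \sum_(a.+1 <= l < b) rho l)%N.
Proof.
move=> ab uE Hp Hd da db; have := count_in_pieces ab uE Hp Hd.
have [|_ pa spa _] := Hp a; first by rewrite leqnn.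
have [|_ pb spb _] := Hp b.-1; first lia.
have := right_changes_vanish spa pa da; have := left_changes_vanish spb pb db.
lia.
Qed.

End ZeroCount.

(** * Interpolation *)
Section Interpolation.
Context {R : rcfType}.
Implicit Types (p q : {poly R}) (zs : seq R).

Lemma interpolation zs (y : R -> R) : uniq zs ->
  exists2 q : {poly R}, (size q <= size zs)%N & {in zs, forall z, q.[z] = y z}.
Proof.
elim: zs => [_|z zs IHzs /= /andP[nz uzs]].
  by exists 0; rewrite ?size_poly0.
have [q sq Hq] := IHzs uzs.
pose w := \prod_(x <- zs) ('X - x%:P).
have wz : w.[z] != 0 by rewrite -/(root _ _) root_prod_XsubC.
exists (q + ((y z - q.[z]) / w.[z]) *: w).
  rewrite (leq_trans (size_polyD _ _)) // geq_max (leq_trans sq) //=.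
  by rewrite (leq_trans (size_scale_leq _ _)) // size_prod_XsubC.
move=> x; rewrite inE => /orP[/eqP ->|xzs]; rewrite hornerD hornerZ.
  by rewrite divfK // addrC subrK.
have /eqP -> : w.[x] == 0 by rewrite -/(root _ _) root_prod_XsubC.
by rewrite mulr0 addr0 Hq.
Qed.

(** One step of the construction of a spline: p' continues p across the knot c and
    has prescribed values at as many points as it has free coefficients. *)
Lemma interpolation_contact (n e : nat) (c : R) zs (y : R -> R) p :
  (size p <= n)%N -> (size zs + e <= n)%N -> uniq zs -> c \notin zs ->
  exists p' : {poly R}, [/\ (size p' <= n)%N, ('X - c%:P) ^+ e %| p - p' &
    {in zs, forall z, p'.[z] = y z}].
Proof.
move=> sp szs uzs czs.
have [q sq Hq] := interpolation (fun z => (y z - p.[z]) / (z - c) ^+ e) uzs.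
exists (p + ('X - c%:P) ^+ e * q); split.
- rewrite (leq_trans (size_polyD _ _)) // geq_max sp.
  have [->|q0] := eqVneq q 0; first by rewrite mulr0 size_poly0.
  rewrite size_monicM ?monic_exp ?monicXsubC // size_exp_XsubC; lia.
- by rewrite opprD addNKr dvdpNr dvdp_mulr.
- move=> z zzs; rewrite hornerD hornerM horner_exp hornerXsubC Hq //.
  rewrite mulrC divfK; first by rewrite addrC subrK.
  by rewrite expf_neq0 // subr_eq0; apply: contraNneq czs => <-.
Qed.

End Interpolation.

Lemma backward_chain (X : Type) (G : X -> Prop) (C : nat -> X -> X -> Prop)
    (N : nat) (x0 : X) :
  (forall j x, (j < N)%N -> G x -> exists2 x', G x' & C j x' x) -> G x0 ->
  exists P : nat -> X, [/\ P N = x0, forall j, (j <= N)%N -> G (P j) &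
    forall j, (j < N)%N -> C j (P j) (P j.+1)].
Proof.
elim: N x0 => [|N IHN] x0 step G0.
  by exists (fun=> x0); split.
have [x Gx Cx] := step N x0 (ltnSn N) G0.
have [|P [PN GP CP]] := IHN x _ Gx; first by move=> j y jN; apply: step; apply: leqW.
exists (fun j => if (j <= N)%N then P j else x0); split; first by rewrite ltnn.
- by move=> j _; case: ifP => // /GP.
- move=> j; rewrite ltnS => jN; rewrite jN; case: ltnP => [/CP //|Nj].
  by have -> : j = N by [apply/eqP; rewrite eqn_leq jN]; rewrite PN.
Qed.

(** * Splines as families of polynomials *)
Section Pieces.
Context {R : rcfType} (m k : nat) (T : nat -> R) (rho : nat -> nat).
Hypothesis k0 : (0 < k)%N.
Hypothesis Tlt : forall j, (j < k)%N -> T j < T j.+1.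
Hypothesis rho0 : rho 0 = m.+1.
Hypothesis rhok : rho k = m.+1.
Hypothesis rhoP : forall j, (0 < j < k)%N -> (1 <= rho j <= m)%N.
Implicit Types (P Q : nat -> {poly R}) (E : seq R).

(** The derivatives of p at T j that a spline has continuous there all vanish:
    a spline can be replaced by zero on one side of T j exactly when its piece on
    the other side has full contact with zero. *)
Definition full_contact j (p : {poly R}) := ('X - (T j)%:P) ^+ (m.+1 - rho j) %| p.

Local Notation contact := full_contact.

(** The polynomial P j is the spline on [T j, T j.+1]; divisibility of the jump by
    the power of X - T j is continuity of the derivatives of order at most
    m - rho j. *)
Definition is_spline P :=
  (forall j, (j < k)%N -> (size (P j) <= m.+1)%N) /\
  (forall j, (0 < j < k)%N -> contact j (P j - P j.-1)).

Definition samples_required a b := (rho a + rho b - 1 + \sum_(a.+1 <= l < b) 2 * rho l)%N.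

Definition enough_samples E := forall a b, (a < b <= k)%N ->
  (samples_required a b <= count_in E (T a) (T b))%N.

Lemma knot_lt i j : (i < j <= k)%N -> T i < T j.
Proof.
move=> /andP[ij jk]; apply: step_lt ij _ => l /andP[_ lj].
exact/Tlt/(leq_trans lj).
Qed.

Lemma block_left (B : pred nat) j : B j -> exists a,
  [/\ (a <= j)%N, forall i, (a <= i <= j)%N -> B i & (0 < a)%N -> ~~ B a.-1].
Proof.
elim: j => [|j IHj] Bj.
  by exists 0%N; split => // i; rewrite leqn0 => /andP[_ /eqP ->].
case: (boolP (B j)) => [/IHj [a [aj Ha Ba]]|nB]; last first.
  exists j.+1; split => // i; rewrite -eqn_leq => /eqP <- //.
exists a; split => // [|i /andP[ai]]; first exact: leqW.
by rewrite leq_eqVlt => /orP[/eqP -> //|ij]; apply: Ha; rewrite ai.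
Qed.

Lemma block_right (B : pred nat) j : (j < k)%N -> B j -> exists b,
  [/\ (j < b <= k)%N, forall i, (j <= i < b)%N -> B i & (b < k)%N -> ~~ B b].
Proof.
have [n] := ubnP (k - j); elim: n j => // n IHn j kn jk Bj.
case: (boolP ((j.+1 < k)%N && B j.+1)) => [/andP[jk' Bj']|].
  have [|b [/andP[jb bk] Hb Bb]] := IHn j.+1 _ jk' Bj'; first lia.
  exists b; split => // [|i /andP[]]; first by rewrite bk ltnW.
  by rewrite leq_eqVlt => /orP[/eqP <- //|ji ib]; apply: Hb; rewrite ji.
rewrite negb_and => nB; exists j.+1; split => [|i|jk'].
- by rewrite ltnSn.
- by rewrite ltnS -eqn_leq => /eqP <-.
- by rewrite jk' /= in nB.
Qed.

Lemma mult_bounds j : (j <= k)%N -> (1 <= rho j <= m.+1)%N.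
Proof.
case: j => [|j jk]; first by rewrite rho0 leqnn.
have [->|jk'] := eqVneq j.+1 k; first by rewrite rhok leqnn.
have := @rhoP j.+1; lia.
Qed.

Lemma contact_left P j : is_spline P -> (j < k)%N -> (0 < j)%N -> P j.-1 = 0 ->
  contact j (P j).
Proof. by case=> _ dvd jk j0 Pj0; rewrite -[P j]subr0 -Pj0 dvd // j0. Qed.

Lemma contact_right P j : is_spline P -> (j < k)%N -> (0 < j)%N -> P j = 0 ->
  contact j (P j.-1).
Proof.
by case=> _ dvd jk j0 Pj0; have := dvd j; rewrite j0 jk Pj0 sub0r /full_contact dvdpNr; apply.
Qed.

Lemma spline_zeros P a b ea eb E :
  is_spline P -> (a < b <= k)%N -> uniq E ->
  (forall j, (a <= j < b)%N -> P j != 0) ->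
  (forall j, (a <= j < b)%N ->
     {in E, forall z, T j <= z <= T j.+1 -> root (P j) z}) ->
  ('X - (T a)%:P) ^+ ea %| P a -> ('X - (T b)%:P) ^+ eb %| P b.-1 ->
  (count_in E (T a) (T b) + ea + eb <= m + \sum_(a.+1 <= l < b) rho l)%N.
Proof.
move=> [sP dP] /andP[ab bk] uE P0 rP; apply: zero_count => // j /andP[aj jb].
  have jk := leq_trans jb bk.
  by split; [exact: Tlt | apply: P0; rewrite aj | exact: sP | apply: rP; rewrite aj].
have H : (0 < j < k)%N by lia.
by split; [exact: rhoP | exact: dP].
Qed.

Lemma block_contact_left P Q a : is_spline P -> is_spline Q -> (a < k)%N ->
  ((0 < a)%N -> ~~ ((P a.-1 != 0) && (Q a.-1 != 0))) ->
  exists ea ea', [/\ ('X - (T a)%:P) ^+ ea %| P a,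
    ('X - (T a)%:P) ^+ ea' %| Q a & (m.+1 <= ea + ea' + rho a)%N].
Proof.
move=> sP sQ ak; case: (posnP a) => [->|a0] H.
  by exists 0%N, 0%N; rewrite !dvd1p rho0.
move: (H isT); rewrite negb_and !negbK => /orP[/eqP z|/eqP z].
  by exists (m.+1 - rho a)%N, 0%N; split; [exact: contact_left | exact: dvd1p | lia].
by exists 0%N, (m.+1 - rho a)%N; split; [exact: dvd1p | exact: contact_left | lia].
Qed.

Lemma block_contact_right P Q b : is_spline P -> is_spline Q -> (0 < b <= k)%N ->
  ((b < k)%N -> ~~ ((P b != 0) && (Q b != 0))) ->
  exists eb eb', [/\ ('X - (T b)%:P) ^+ eb %| P b.-1,
    ('X - (T b)%:P) ^+ eb' %| Q b.-1 & (m.+1 <= eb + eb' + rho b)%N].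
Proof.
move=> sP sQ /andP[b0]; rewrite leq_eqVlt => /orP[/eqP -> _|bk H].
  by exists 0%N, 0%N; rewrite !dvd1p rhok.
move: (H bk); rewrite negb_and !negbK => /orP[/eqP z|/eqP z].
  by exists (m.+1 - rho b)%N, 0%N; split; [exact: contact_right | exact: dvd1p | lia].
by exists 0%N, (m.+1 - rho b)%N; split; [exact: dvd1p | exact: contact_right | lia].
Qed.

Lemma samples_requiredE a b :
  samples_required a b = (rho a + rho b - 1 + 2 * \sum_(a.+1 <= l < b) rho l)%N.
Proof. by rewrite /samples_required big_distrr. Qed.

(** On a maximal block of pieces where both splines are nonzero, each end costs one
    of them a full contact; the zeros of both together are then at most one less
    than the number of samples required. *)
Theorem enough_samples_product0 E P Q (u v : R -> R) :
  uniq E -> enough_samples E -> is_spline P -> is_spline Q ->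
  (forall j, (j < k)%N -> {in E, forall x, T j <= x <= T j.+1 ->
     (P j).[x] = u x /\ (Q j).[x] = v x}) ->
  {in E, forall x, u x * v x = 0} ->
  forall j, (j < k)%N -> P j = 0 \/ Q j = 0.
Proof.
move=> uE dE sP sQ uv uv0 j jk.
case: (boolP ((P j != 0) && (Q j != 0))) => [Bj|]; last first.
  by rewrite negb_and !negbK => /orP[]/eqP ->; [left | right].
pose B i := (P i != 0) && (Q i != 0).
have [a [aj Ba Na]] := @block_left B _ Bj.
have [b [/andP[jb bk] Bb Nb]] := @block_right B _ jk Bj.
have ab := leq_ltn_trans aj jb.
have BB i : (a <= i < b)%N -> B i.
  move=> /andP[ai ib]; case: (leqP i j) => ij; first by apply: Ba; rewrite ai.
  by apply: Bb; rewrite ib ltnW.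
have [ea [ea' [ea1 ea2 ea3]]] := block_contact_left sP sQ (leq_trans ab bk) Na.
have [|eb [eb' [eb1 eb2 eb3]]] := block_contact_right sP sQ _ Nb; first lia.
have abk : (a < b <= k)%N by rewrite ab.
have rk i : (a <= i < b)%N -> (i < k)%N by lia.
have HP := @spline_zeros P a b ea eb [seq x <- E | u x == 0] sP abk
  (filter_uniq _ uE) (fun i H => proj1 (andP (BB i H))) _ ea1 eb1.
have {}HP : (count_in [seq x <- E | (u x == 0)%R] (T a) (T b) + ea + eb
    <= m + \sum_(a.+1 <= l < b) rho l)%N.
  apply: HP => i /rk ik x; rewrite mem_filter => /andP[/eqP ux xE] Tx.
  by rewrite /root (proj1 (uv _ ik _ xE Tx)) ux.
have HQ := @spline_zeros Q a b ea' eb' [seq x <- E | v x == 0] sQ abk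
  (filter_uniq _ uE) (fun i H => proj2 (andP (BB i H))) _ ea2 eb2.
have {}HQ : (count_in [seq x <- E | (v x == 0)%R] (T a) (T b) + ea' + eb'
    <= m + \sum_(a.+1 <= l < b) rho l)%N.
  apply: HQ => i /rk ik x; rewrite mem_filter => /andP[/eqP vx xE] Tx.
  by rewrite /root (proj2 (uv _ ik _ xE Tx)) vx.
have Hc : (count_in E (T a) (T b) <= count_in [seq x <- E | (u x == 0)%R] (T a) (T b)
    + count_in [seq x <- E | (v x == 0)%R] (T a) (T b))%N.
  rewrite /count_in !count_filter -count_predUI; apply: leq_trans (leq_addr _ _).
  rewrite -!size_filter; apply: uniq_leq_size (filter_uniq _ uE) _ => x.
  rewrite !mem_filter => /andP[Tx xE]; rewrite xE /= Tx /=.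
  by have /eqP := uv0 _ xE; rewrite mulf_eq0 andbT.
have := dE _ _ abk; rewrite samples_requiredE.
have := @mult_bounds a; have := @mult_bounds b; lia.
Qed.

Lemma contact_root j p : (0 < j < k)%N -> contact j p -> root p (T j).
Proof.
move=> /rhoP jb; rewrite /full_contact.
have -> : (m.+1 - rho j = (m - rho j).+1)%N by lia.
exact: dvdp_exp_root.
Qed.

Lemma knot_le i j : (i <= j <= k)%N -> T i <= T j.
Proof.
by rewrite leq_eqVlt => /andP[/orP[/eqP ->//|ij] jk]; rewrite ltW // knot_lt // ij.
Qed.

Lemma count_in_knots (F : seq R) a b : uniq F -> (a < b <= k)%N ->
  (forall j, (a < j < b)%N -> T j \notin F) ->
  count_in F (T a) (T b) = (\sum_(a <= i < b) count_in F (T i) (T i.+1))%N.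
Proof.
move=> uF; elim: b => // b IHb /andP[]; rewrite ltnS leq_eqVlt => /orP[/eqP <-|ab] bk H.
  by rewrite big_nat1.
rewrite big_nat_recr ?(ltnW ab) //= -IHb ?ab ?(ltnW bk) //; last first.
  by move=> j /andP[aj jb]; apply: H; rewrite aj ltnW.
rewrite (@count_in_split _ _ _ (T b)) ?Tlt ?knot_lt ?ab ?(ltnW bk) //.
by rewrite (negbTE (H b _)) ?ab ?ltnSn // addn0.
Qed.

(** Built from the right: the first piece is chosen with its zeros and with contact
    at T b, each further piece by interpolation. Left of T a the only care is to
    avoid zeros at the knots. If the spline had full contact at a knot between
    T a and T b, the pieces from there (or from a later knot) up to T b would have
    more zeros than zero_count allows. *)
Theorem backward_spline (a b : nat) (F : seq R) :
  (a < b <= k)%N -> uniq F -> {in F, forall x, T a < x < T b} ->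
  (forall j, (a < j < b)%N -> T j \notin F) ->
  (forall c, (a <= c)%N -> (c.+1 < b)%N ->
     count_in F (T c) (T c.+1) = rho c.+1) ->
  (count_in F (T b.-1) (T b) < rho b)%N ->
  exists P : nat -> {poly R}, [/\ is_spline P, P b.-1 != 0,
    forall j, (b <= j)%N -> P j = 0,
    forall j, (a <= j < b)%N -> {in F, forall x, T j <= x <= T j.+1 -> root (P j) x}
  & forall j, (0 < j < b)%N -> ~~ contact j (P j)].
Proof.
move=> /andP[ab bk] uF abF nF cF cFb.
pose A c := [seq x <- F | T c < x < T c.+1].
have sA c : size (A c) = count_in F (T c) (T c.+1) by rewrite size_filter.
(* If the last cell has fewer points than allowed, the order of vanishing at T b
   makes up for them: the total number of zeros of the first piece is always m. *)
pose eb := (m - size (A b.-1))%N.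
pose pb : {poly R} := ('X - (T b)%:P) ^+ eb * \prod_(z <- A b.-1) ('X - z%:P).
have pb0 : pb != 0.
  by rewrite mulf_neq0 ?expf_neq0 ?polyXsubC_eq0 // monic_neq0 ?monic_prod_XsubC.
have rhob := mult_bounds bk.
have bE : b.-1.+1 = b by lia.
have spb : (size pb <= m.+1)%N.
  rewrite size_Mmonic ?monic_prod_XsubC ?expf_neq0 ?polyXsubC_eq0 //.
  rewrite size_exp_XsubC size_prod_XsubC /eb sA bE; lia.
pose C j (p p' : {poly R}) := [/\ contact j.+1 (p' - p), (a <= j)%N -> {in A j, forall x, root p x}
  & (j < a)%N -> p.[T j] = 1].
have [|P [Pb sP CP]] := @backward_chain {poly R} (fun p => (size p <= m.+1)%N) C b.-1 pb _ spb.
  move=> j p jb sp; have jk : (j.+1 <= k)%N by lia.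
  have rj := mult_bounds jk.
  case: (leqP a j) => aj.
    have [|||p' [sp' dp' rp']] := @interpolation_contact _ m.+1 (m.+1 - rho j.+1)%N
      (T j.+1) (A j) (fun=> 0) p sp.
    - rewrite sA cF //; lia.
    - exact: filter_uniq.
    - by rewrite mem_filter ltxx andbF.
    by exists p' => //; split=> // [_ x /rp'/eqP //|ja]; lia.
  have [|||p' [sp' dp' rp']] := @interpolation_contact _ m.+1 (m.+1 - rho j.+1)%N
    (T j.+1) [:: T j] (fun=> 1) p sp; rewrite ?inE ?gt_eqF ?Tlt //=; first lia.
  by exists p' => //; split=> // [ja|_]; [lia | apply: rp'; rewrite inE].
pose P' j := if (j < b)%N then P j else 0.
have P'b : P' b.-1 = pb by rewrite /P' -Pb; case: ltnP => //; lia.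
have P'E j : (j < b)%N -> P' j = P j by rewrite /P' => ->.
have P'z j : (b <= j)%N -> P' j = 0 by rewrite /P' leqNgt => /negbTE ->.
have eb1 : ('X - (T b)%:P) ^+ eb %| P' b.-1 by rewrite P'b dvdp_mulr.
have spl : is_spline P'.
  split=> [j jk|j /andP[j0 jk]].
    by rewrite /P'; case: ltnP => jb; [apply: sP; lia | rewrite size_poly0].
  case: (ltngtP j b) => jb.
  - rewrite !P'E; [|lia..].
    by have [|+ _ _] := CP j.-1; [lia | rewrite prednK].
  - by rewrite !P'z ?subrr; [exact: dvdp0|lia..].
  - rewrite (P'z j) ?jb // sub0r /full_contact dvdpNr; apply: dvdp_trans eb1.
    by rewrite dvdp_exp2l // /eb sA bE; lia.
have rt j : (a <= j < b)%N -> {in F, forall x, T j <= x <= T j.+1 -> root (P' j) x}.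
  move=> /andP[aj jb] x xF /andP[jx xj]; have xA : x \in A j.
    rewrite mem_filter xF andbT !lt_neqAle jx xj !andbT.
    have := abF _ xF; case: (eqVneq (T j) x) => [Tx|_].
      move: aj; rewrite leq_eqVlt => /orP[/eqP aj|aj].
        by rewrite aj Tx ltxx.
      by have := nF j; rewrite aj jb Tx xF => /(_ isT).
    case: (eqVneq x (T j.+1)) => [Tx|//]; move: jb; rewrite leq_eqVlt => /orP[/eqP jb|jb].
      by rewrite -jb -Tx ltxx andbF.
    by have := nF j.+1; rewrite ltnS aj jb -Tx xF => /(_ isT).
  have [jE|jb'] := eqVneq j b.-1; last first.
    by rewrite P'E //; have [|_ /(_ aj) + _] := CP j; [lia | apply].
  by rewrite jE P'b rootM root_prod_XsubC -jE xA orbT.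
exists P'; split=> // [|j /andP[j0 jb]]; first by rewrite P'b.
apply/negP => cj; have jk : (0 < j < k)%N by rewrite j0 (leq_trans jb).
case: (ltnP j a) => ja.
  have [|_ _ /(_ ja) H] := CP j; first lia.
  have := contact_root jk cj; rewrite P'E // /root H => /eqP; apply/eqP.
  exact: oner_neq0.
pose B i := (P' i != 0) && (j <= i)%N.
have [|c [cb Bc Nc]] := @block_left B b.-1; first by rewrite /B P'b pb0; lia.
have jc : (j <= c)%N by have := Bc c; rewrite leqnn cb => /(_ isT) /andP[].
have cc : contact c (P' c).
  have [<- //|jc'] := eqVneq j c.
  apply: contact_left => //; [lia..|].
  have := Nc; rewrite /B negb_and negbK => /(_ _)/orP[|/eqP //|]; lia.
have cbk : (c < b <= k)%N by lia.
have := @spline_zeros P' c b _ _ F spl cbk uF _ _ cc eb1.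
have rc := @rhoP c.
suff : (\sum_(c.+1 <= l < b) rho l + count_in F (T b.-1) (T b) <= count_in F (T c) (T b))%N.
  have nz i : (c <= i < b)%N -> P' i != 0.
    by move=> ?; have /andP[] : B i by apply: Bc; lia.
  have rz i : (c <= i < b)%N ->
      {in F, forall z, T i <= z <= T i.+1 -> root (P' i) z}.
    by move=> ?; apply: rt; lia.
  move=> H1 /(_ nz rz); rewrite /eb sA bE; lia.
rewrite (@count_in_knots F c b) //; last by move=> i ?; apply: nF; lia.
have -> : (\sum_(c <= i < b) count_in F (T i) (T i.+1) =
  \sum_(c <= i < b.-1) count_in F (T i) (T i.+1) + count_in F (T b.-1) (T b))%N.
  by rewrite -{1}bE big_nat_recr /= ?bE //; lia.
rewrite leq_add2r -{1}bE big_add1 /=.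
by rewrite !big_nat; apply: leq_sum => i ?; rewrite cF //; lia.
Qed.

End Pieces.

(** * Splines built from the left *)
Section Forward.
Context {R : rcfType} (m k : nat) (T : nat -> R) (rho : nat -> nat).
Hypothesis k0 : (0 < k)%N.
Hypothesis Tlt : forall j, (j < k)%N -> T j < T j.+1.
Hypothesis rho0 : rho 0 = m.+1.
Hypothesis rhok : rho k = m.+1.
Hypothesis rhoP : forall j, (0 < j < k)%N -> (1 <= rho j <= m)%N.
Local Notation contact := (full_contact m T rho).
Local Notation is_spline := (is_spline m k T rho).

Lemma comp_polyNXK (p : {poly R}) : (p \Po - 'X) \Po - 'X = p.
Proof. by rewrite -comp_polyA raddfN /= comp_polyX opprK comp_polyXr. Qed.

Lemma dvdp_exp_reflect e (c : R) (p : {poly R}) :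
  (('X - c%:P) ^+ e %| p \Po - 'X) = (('X - (- c)%:P) ^+ e %| p).
Proof.
have reflect (d : R) (q : {poly R}) : ('X - (- d)%:P) ^+ e %| q ->
    ('X - d%:P) ^+ e %| q \Po - 'X.
  move=> /(dvdp_comp_poly (- 'X)); apply: dvdp_trans.
  rewrite rmorphXn /= comp_polyB comp_polyX comp_polyC polyCN opprK.
  by rewrite (addrC (- 'X)) -(opprB 'X) exprNn dvdp_mull.
apply/idP/idP => [|/reflect //]; rewrite -{1}[c]opprK => /reflect.
by rewrite comp_polyNXK.
Qed.

Lemma count_in_opp (F : seq R) x y :
  count_in (map -%R F) (- y) (- x) = count_in F x y.
Proof.
by rewrite /count_in count_map; apply: eq_count => z /=; rewrite !ltrN2 andbC.
Qed.

(** The mirror image of backward_spline under x |-> - x, which sends the knot T j to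
    - T j at position k - j. *)
Theorem forward_spline (a b : nat) (F : seq R) :
  (a < b <= k)%N -> uniq F -> {in F, forall x, T a < x < T b} ->
  (forall j, (a < j < b)%N -> T j \notin F) ->
  (forall c, (a < c < b)%N -> count_in F (T c) (T c.+1) = rho c) ->
  (count_in F (T a) (T a.+1) < rho a)%N ->
  exists P : nat -> {poly R}, [/\ is_spline P, P a != 0,
    forall j, (j < a)%N -> P j = 0,
    forall j, (a <= j < b)%N -> {in F, forall x, T j <= x <= T j.+1 -> root (P j) x}
  & forall j, (a < j < k)%N -> ~~ contact j (P j)].
Proof.
move=> /andP[ab bk] uF abF nF cF cFa.
pose T' j := - T (k - j)%N; pose rho' j := rho (k - j)%N; pose F' := map -%R F.
have memF' x : (x \in F') = (- x \in F).
  by rewrite -{1}[x]opprK (mem_map oppr_inj).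
have Tlt' j : (j < k)%N -> T' j < T' j.+1.
  by move=> jk; rewrite ltrN2 subnS -[X in _ < T X](prednK (n := k - j)) ?Tlt //; lia.
have rhoP' j : (0 < j < k)%N -> (1 <= rho' j <= m)%N by move=> H; apply: rhoP; lia.
have kS j : (j < k)%N -> (k - (k - j.+1) = j.+1)%N by lia.
have [||||||||P [sP Pb Pz Pr Pc]] :=
  @backward_spline R m k T' rho' k0 Tlt' _ _ rhoP' (k - b) (k - a) F'.
- by rewrite /rho' subn0.
- by rewrite /rho' subnn.
- lia.
- by rewrite map_inj_uniq //; apply: oppr_inj.
- move=> x; rewrite memF' => /abF /andP[ax xb].
  by rewrite /T' !subKn ?(ltnW (leq_trans ab bk)) // ltrNl ltrNr xb.
- by move=> j H; rewrite memF' opprK; apply: nF; lia.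
- move=> c ac cb; rewrite /T' count_in_opp /rho' -cF; last lia.
  by congr (count_in _ _ (T _)); lia.
- have -> : (k - a).-1 = (k - a.+1)%N by lia.
  by rewrite /T' count_in_opp /rho' !subKn //; lia.
have dP j : (0 < j < k)%N -> contact j ((P (k.-1 - j)%N \Po - 'X) - (P (k.-1 - j.-1)%N \Po - 'X)).
  move=> jk; have [_ /(_ (k - j)%N)] := sP; rewrite /full_contact -comp_polyB dvdp_exp_reflect.
  rewrite /T' /rho' subKn; last lia.
  have -> : (k.-1 - j = (k - j).-1)%N by lia.
  have -> : (k.-1 - j.-1 = k - j)%N by lia.
  by rewrite -dvdpNr opprB; apply; lia.
exists (fun j => P (k.-1 - j)%N \Po - 'X); split.
- split=> // j jk; rewrite size_comp_poly2 ?size_polyN ?size_polyX //.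
  by have [+ _] := sP; apply; lia.
- apply: contraNneq Pb => H; have <- : (k.-1 - a = (k - a).-1)%N by lia.
  by rewrite -(comp_polyNXK (P _)) H comp_poly0.
- by move=> j ja; rewrite Pz ?comp_poly0 //; lia.
- move=> j jab x xF /andP[jx xj]; rewrite /root horner_comp hornerN hornerX.
  have := Pr (k.-1 - j)%N _ (- x); rewrite memF' opprK; apply=> //; first lia.
  have E1 : (k - (k.-1 - j) = j.+1)%N by lia.
  have E2 : (k - (k.-1 - j).+1 = j)%N by lia.
  by rewrite /T' E1 E2 !lerN2 xj jx.
- move=> j ajk; apply/negP => cj; have jk : (0 < j < k)%N by lia.
  have jk' : (0 < k - j < k - a)%N by lia.
  have /negP := Pc _ jk'; apply.
  have := dP j jk; move: cj; rewrite /full_contact => cj.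
  rewrite dvdp_subr // dvdp_exp_reflect /T' /rho' subKn; last lia.
  by have -> : (k.-1 - j.-1 = k - j)%N by lia.
Qed.

End Forward.

(** * Two splines whose product vanishes on a sparse set *)
Lemma count_add (A : Type) (p p1 p2 : pred A) (s : seq A) :
  (forall x, p x = p1 x + p2 x :> nat)%N ->
  (count p s = count p1 s + count p2 s)%N.
Proof. by move=> H; elim: s => //= x s ->; rewrite H addnACA. Qed.

Lemma count_take (A : eqType) (n : nat) (s : seq A) : uniq s ->
  count (mem (take n s)) s = minn n (size s).
Proof.
move=> us; rewrite -{2}(cat_take_drop n s) count_cat.
have /eqP -> : count (mem (take n s)) (take n s) == size (take n s).
  by rewrite -all_count; apply/allP.
have -> : count (mem (take n s)) (drop n s) = 0%N.
  apply/eqP; rewrite -leqn0 leqNgt -has_count; apply/hasP => -[x xd xt].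
  by move: us; rewrite -(cat_take_drop n s) cat_uniq => /and3P[_ /hasP[]]; exists x.
by rewrite addn0 size_take_min.
Qed.

(** Among n + 1 distinct candidates, n conditions exclude at most one each. *)
Lemma generic_scalar (R : numFieldType) (n : nat) (bad : nat -> pred R) :
  (forall j x y, (j < n)%N -> bad j x -> bad j y -> x = y) ->
  exists2 x, x != 0 & forall j, (j < n)%N -> ~~ bad j x.
Proof.
move=> bad1.
have gen l (s : seq R) : (l <= n)%N -> uniq s -> (l < size s)%N ->
    exists2 x, x \in s & forall j, (j < l)%N -> ~~ bad j x.
  elim: l s => [|l IHl] [|x0 s] // ln us ls.
    by exists x0; rewrite ?mem_head.
  have [|||x] := IHl [seq x <- x0 :: s | ~~ bad l x].
  - exact: ltnW.
  - exact: filter_uniq.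
  - rewrite size_filter -[count _ _]/(count (predC (bad l)) (x0 :: s)).
    have := count_predC (bad l) (x0 :: s).
    suff : (count (bad l) (x0 :: s) <= 1)%N.
      by move: ls; lia.
    rewrite -size_filter; have := filter_uniq (bad l) us.
    have : {in [seq x <- x0 :: s | bad l x] &, forall x y, x = y}.
      by move=> x y; rewrite !mem_filter => /andP[bx _] /andP[by_ _]; apply: bad1 bx by_.
    case: (seq.filter _ _) => [|x [|y r]] // H; rewrite /= (H x y) ?inE ?eqxx ?orbT //.
  rewrite mem_filter => /andP[nb xs] Hx; exists x => // j.
  by rewrite ltnS leq_eqVlt => /orP[/eqP -> //|/Hx].
have [|||x] := gen n [seq i.+1%:R | i <- iota 0 n.+1].
- exact: leqnn.
- by rewrite map_inj_uniq ?iota_uniq // => i j /eqP; rewrite eqr_nat => /eqP[].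
- by rewrite size_map size_iota.
by case/mapP => i _ -> H; exists i.+1%:R => //; rewrite pnatr_eq0.
Qed.

Section Witness.
Context {R : rcfType} (m k : nat) (T : nat -> R) (rho : nat -> nat).
Hypothesis k0 : (0 < k)%N.
Hypothesis Tlt : forall j, (j < k)%N -> T j < T j.+1.
Hypothesis rho0 : rho 0 = m.+1.
Hypothesis rhok : rho k = m.+1.
Hypothesis rhoP : forall j, (0 < j < k)%N -> (1 <= rho j <= m)%N.
Local Notation knot_lt := (knot_lt Tlt).
Local Notation knot_le := (knot_le Tlt).
Local Notation mult_bounds := (mult_bounds k0 rho0 rhok rhoP).
Local Notation contact := (full_contact m T rho).
Local Notation is_spline := (is_spline m k T rho).
Local Notation samples_required := (samples_required rho).

Lemma cell_inj c d x : (c < k)%N -> (d < k)%N ->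
  T c < x < T c.+1 -> T d < x < T d.+1 -> c = d.
Proof.
move=> ck dk /andP[cx xc] /andP[dx xd].
case: (ltngtP c d) => // [cd|dc].
  have : T c.+1 <= T d by apply: knot_le; rewrite cd ltnW.
  by move/(lt_le_trans xc)/(lt_trans dx); rewrite ltxx.
have : T d.+1 <= T c by apply: knot_le; rewrite dc ltnW.
by move/(lt_le_trans xd)/(lt_trans cx); rewrite ltxx.
Qed.

(** In the cell c the first n c points go to F1 and the others to F2. *)
Lemma split_points (E : seq R) a b (n : nat -> nat) :
  (a < b <= k)%N -> uniq E -> (forall j, (a < j < b)%N -> T j \notin E) ->
  exists F1 F2 : seq R,
  [/\ uniq F1 /\ uniq F2,
      {in F1, forall x, (T a < x < T b) && (x \in E)} /\
      {in F2, forall x, (T a < x < T b) && (x \in E)},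
      {in E, forall x, T a < x < T b -> (x \in F1) || (x \in F2)} &
      forall c, (a <= c < b)%N ->
        count_in F1 (T c) (T c.+1) = minn (n c) (count_in E (T c) (T c.+1)) /\
        count_in F2 (T c) (T c.+1) = (count_in E (T c) (T c.+1) - n c)%N].
Proof.
move=> /andP[ab bk] uE nE.
pose s c := [seq x <- E | T c < x < T c.+1].
pose sel x := has (fun c => x \in take (n c) (s c)) (iota a (b - a)).
have in_cell c x : x \in take (n c) (s c) -> T c < x < T c.+1.
  by move=> /mem_take; rewrite mem_filter => /andP[].
have cell_ab c x : (a <= c < b)%N -> T c < x < T c.+1 -> T a < x < T b.
  move=> /andP[ac cb] /andP[cx xc]; have ck := leq_trans cb bk.
  rewrite (le_lt_trans _ cx) ?(lt_le_trans xc) // knot_le ?ac ?cb // ltnW //.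
exists [seq x <- E | sel x], [seq x <- E | (T a < x < T b) && ~~ sel x].
split.
- by split; apply: filter_uniq.
- split=> x; rewrite mem_filter => /andP[]; last by move=> /andP[-> _] ->.
  move=> /hasP[c]; rewrite mem_iota => Hc /in_cell xc ->.
  by rewrite andbT (cell_ab c) //; lia.
- by move=> x xE xab; rewrite !mem_filter xE xab; case: (sel x).
move=> c /andP[ac cb]; have ck := leq_trans cb bk.
have E1 : count_in [seq x <- E | sel x] (T c) (T c.+1)
    = minn (n c) (count_in E (T c) (T c.+1)).
  have -> : count_in E (T c) (T c.+1) = size (s c) by rewrite size_filter.
  rewrite -count_take ?filter_uniq // /count_in !count_filter; apply: eq_in_count => x xE /=.
  rewrite andbC; case: (boolP (T c < x < T c.+1)) => xc; last by rewrite !andbF.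
  rewrite !andbT; apply/hasP/idP => [[d]|xt].
    rewrite mem_iota => Hd xt; have dk : (d < k)%N by lia.
    by rewrite (cell_inj ck dk xc (in_cell _ _ xt)).
  by exists c => //; rewrite mem_iota; lia.
split=> //; have : (count_in E (T c) (T c.+1)
    = count_in [seq x <- E | sel x] (T c) (T c.+1)
    + count_in [seq x <- E | (T a < x < T b)%R && ~~ sel x] (T c) (T c.+1))%N; last lia.
rewrite /count_in !count_filter; apply: count_add => x /=.
case: (boolP (T c < x < T c.+1)) => //= xc.
by rewrite (cell_ab c) ?ac //=; case: (sel x).
Qed.

(** The requirement is superadditive up to one: this missing unit is the whole
    reason why minimal gaps are rigid. *)
Lemma samples_required_split a d b : (a < d < b)%N -> (0 < rho a)%N -> (0 < rho d)%N ->
  (0 < rho b)%N -> (samples_required a d + samples_required d b).+1 = samples_required a b.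
Proof.
move=> /andP[ad db] ra rd rb; rewrite !samples_requiredE.
rewrite (big_cat_nat (n := d) (m := a.+1) (p := b)) ?(ltnW db) //=.
rewrite (big_ltn (m := d)) //; lia.
Qed.

Lemma minimal_gap E a b : (a < b <= k)%N ->
  (count_in E (T a) (T b) < samples_required a b)%N ->
  exists a' b', [/\ (a' < b' <= k)%N,
    (count_in E (T a') (T b') < samples_required a' b')%N &
    forall c d, (a' <= c)%N -> (c < d <= b')%N -> (d - c < b' - a')%N ->
      (samples_required c d <= count_in E (T c) (T d))%N].
Proof.
have [n] := ubnP (b - a); elim: n a b => // n IHn a b; rewrite ltnS => ban abk gap.
case: (boolP [exists c : 'I_k.+1, exists d : 'I_k.+1,
   [&& (a <= c)%N, (c < d <= b)%N, (d - c < b - a)%N &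
     (count_in E (T c) (T d) < samples_required c d)%N]]).
  move=> /existsP[c /existsP[d /and4P[ac cdb dc gap']]].
  apply: (IHn c d _ _ gap'); first exact: leq_trans dc ban.
  lia.
move=> H; exists a, b; split => // c d ac cdb dc; rewrite leqNgt.
apply: contra H => gap'.
have ck : (c < k.+1)%N by lia.
have dk : (d < k.+1)%N by lia.
by apply/existsP; exists (Ordinal ck); apply/existsP; exists (Ordinal dk); rewrite /= ac cdb dc.
Qed.

(** Each of the two subintervals at T d has enough points, which already exceeds
    what the gap allows unless both counts are exact and T d is not a sample. *)
Lemma minimal_gap_counts E a b : uniq E -> (a < b <= k)%N ->
  (count_in E (T a) (T b) < samples_required a b)%N ->
  (forall c d, (a <= c)%N -> (c < d <= b)%N -> (d - c < b - a)%N ->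
      (samples_required c d <= count_in E (T c) (T d))%N) ->
  forall d, (a < d < b)%N -> T d \notin E /\
    count_in E (T a) (T d) = samples_required a d.
Proof.
move=> uE abk gap Hmin d adb; have /andP[ad db] := adb; have /andP[ab bk] := abk.
have TT : T a < T d /\ T d < T b by rewrite !knot_lt //; lia.
have Hs := count_in_split uE TT.1 TT.2.
have Hr : (samples_required a d + samples_required d b).+1 = samples_required a b.
  have [ak dk] : (a <= k)%N /\ (d <= k)%N by lia.
  have := mult_bounds ak; have := mult_bounds bk; have := mult_bounds dk.
  by move=> *; apply: samples_required_split => //; lia.
have := Hmin a d; have := Hmin d b.
case: (T d \in E) Hs => /=; lia.
Qed.

(** Differences of the exact counts of minimal_gap_counts; only a gap reduced to a
    single cell may contain fewer points. *)
Lemma minimal_gap_cells E a b : uniq E -> (a < b <= k)%N ->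
  (count_in E (T a) (T b) < samples_required a b)%N ->
  (forall c d, (a <= c)%N -> (c < d <= b)%N -> (d - c < b - a)%N ->
      (samples_required c d <= count_in E (T c) (T d))%N) ->
  forall c, (a <= c < b)%N ->
    (a.+1 = b -> (count_in E (T c) (T c.+1) <= rho a + rho b - 2)%N) /\
    (a.+1 != b -> count_in E (T c) (T c.+1) = (rho c + rho c.+1 - (c == a) - (c.+1 == b))%N).
Proof.
move=> uE abk gap Hmin c acb; have /andP[ac cb] := acb; have /andP[ab bk] := abk.
have rb x : (x <= k)%N -> (1 <= rho x <= m.+1)%N by apply: mult_bounds.
have ra := rb a (ltnW (leq_trans ab bk)); have rbb := rb b bk.
split=> [abE|nab].
  have cE : c = a by lia.
  move: gap; rewrite cE abE samples_requiredE big_geq ?abE //; lia.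
have key := minimal_gap_counts uE abk gap Hmin.
have ck : (c < k)%N by lia.
have rc := rb c (ltnW ck); have rc1 := rb c.+1 ck.
have req1 x : samples_required x x.+1 = (rho x + rho x.+1 - 1)%N.
  by rewrite samples_requiredE big_geq // muln0 addn0.
case: (eqVneq c a) => [->|ca].
  have [|_ ->] := key a.+1; first lia.
  rewrite req1 (negbTE nab); lia.
have ac' : (a < c)%N by lia.
have [|nc Hac] := key c; first lia.
have TT : T a < T c /\ T c < T c.+1 by rewrite knot_lt ?Tlt //; lia.
have Hs := count_in_split uE TT.1 TT.2; rewrite (negbTE nc) addn0 Hac in Hs.
have Hr : (samples_required a c + samples_required c c.+1).+1 = samples_required a c.+1.
  apply: samples_required_split; lia.
rewrite req1 in Hr; case: (eqVneq c.+1 b) => cb'; last first.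
  have [|_] := key c.+1; [lia|rewrite Hs; lia].
have := Hmin c c.+1 (ltnW ac'); rewrite req1 -cb' in gap *; lia.
Qed.

(** Cell c of a minimal gap has rho c + rho c.+1 points, one less in the first cell
    and one less in the last: exactly enough to feed both constructions. *)
Theorem gap_witness E a b : uniq E -> {in E, forall x, T 0 < x < T k} ->
  (a < b <= k)%N -> (count_in E (T a) (T b) < samples_required a b)%N ->
  exists P Q : nat -> {poly R},
  [/\ is_spline P /\ is_spline Q,
      exists2 i, (i < k)%N & P i != 0,
      exists2 i, (i < k)%N & Q i != 0,
      {in E, forall x j, (j < k)%N -> T j <= x <= T j.+1 ->
         root (P j) x || root (Q j) x} &
      forall j, (0 < j < k)%N -> ~~ (contact j (P j) && contact j (Q j))].
Proof.
move=> uE E0k abk0 gap0; have [{abk0 gap0}a [{}b [abk gap Hmin]]] := minimal_gap abk0 gap0.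
have cells := minimal_gap_cells uE abk gap Hmin.
have knots j : (a < j < b)%N -> T j \notin E.
  by move=> /(minimal_gap_counts uE abk gap Hmin) [].
have /andP[ab bk] := abk; have ak := leq_trans ab bk.
have rb x : (x <= k)%N -> (1 <= rho x <= m.+1)%N by apply: mult_bounds.
have ra := rb a (ltnW ak); have rbb := rb b bk.
have [F1 [F2 [[u1 u2] [in1 in2] cover sizes]]] :=
  split_points (fun c => rho c.+1 - (c.+1 == b))%N abk uE knots.
have [||||P [sP P0 Pz Pr Pc]] := @backward_spline R m k T rho k0 Tlt rho0 rhok rhoP a b F1 abk u1.
- by move=> x /in1 /andP[].
- by move=> j /knots; apply: contraNN => /in1 /andP[].
- move=> c ac cb; have [|-> _] := sizes c; first lia.
  have [|_ ca2] := cells c; first lia.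
  have := ca2 _; have := rb c; have := rb c.+1; lia.
- have [|+ _] := sizes b.-1; first lia.
  by have -> : b.-1.+1 = b; [lia | move=> ->; rewrite eqxx; lia].
have [||||Q [sQ Q0 Qz Qr Qc]] := @forward_spline R m k T rho k0 Tlt rho0 rhok rhoP a b F2 abk u2.
- by move=> x /in2 /andP[].
- by move=> j /knots; apply: contraNN => /in2 /andP[].
- move=> c acb; have [|_ ->] := sizes c; first lia.
  have [|_ ca2] := cells c; first lia.
  have := ca2 _; have := rb c; have := rb c.+1; lia.
- have [|_ ->] := sizes a; first lia.
  have [|ca1 ca2] := cells a; first by rewrite leqnn.
  have ra1 := rb a.+1 ak; case: (eqVneq a.+1 b) ca1 ca2 => [ab1 /(_ ab1)|nab _ /(_ isT)].
    rewrite ab1; lia.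
  rewrite eqxx; lia.
exists P, Q; split.
- by [].
- by exists b.-1 => //; lia.
- by exists a.
- move=> x xE j jk jx; case: (leqP b j) => bj; first by rewrite Pz // /root horner0 eqxx.
  case: (ltnP j a) => ja; first by rewrite Qz // /root horner0 eqxx orbT.
  have jab : (a <= j < b)%N by rewrite ja.
  have /andP[x0 xk] := E0k _ xE.
  have Tax : T a <= x by case/andP: jx => jx _; apply: le_trans jx; apply: knot_le; rewrite ja ltnW.
  have Txb : x <= T b by case/andP: jx => _ /le_trans; apply; apply: knot_le; rewrite bj.
  move: Tax; rewrite le_eqVlt => /orP[/eqP Tax|Tax].
    have a0 : (0 < a < k)%N.
      by rewrite ak andbT lt0n; apply: contraTneq x0 => a0; rewrite -Tax a0 ltxx.
    have ja0 : j = a.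
      apply/eqP; rewrite eqn_leq ja andbT leqNgt; apply/negP => aj.
      have : T a < T j by apply: knot_lt; rewrite aj ltnW.
      by case/andP: jx => + _; rewrite -Tax leNgt => /negbTE ->.
    have /andP[a1 _] := a0.
    have Qa : contact a (Q a).
      by apply: (contact_left (k := k)) => //; apply: Qz; rewrite ltn_predL.
    by rewrite ja0 -Tax (contact_root k0 rho0 rhok rhoP a0 Qa) orbT.
  move: Txb; rewrite le_eqVlt => /orP[/eqP Txb|Txb].
    have b0 : (0 < b < k)%N.
      rewrite (leq_trans _ ab) // ltn_neqAle bk andbT.
      by apply: contraTneq xk => bk1; rewrite -bk1 -Txb ltxx.
    have jb0 : j.+1 = b.
      apply/eqP; rewrite eqn_leq bj leqNgt; apply/negP => jb.
      have : T j.+1 < T b by apply: knot_lt; rewrite jb.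
      by case/andP: jx => _; rewrite Txb leNgt => /negbTE ->.
    have /andP[b1 b2] := b0.
    have Pb : contact b (P b.-1).
      by apply: (contact_right (k := k)) => //; apply: Pz.
    by rewrite -[j]/(j.+1.-1) jb0 Txb (contact_root k0 rho0 rhok rhoP b0 Pb).
  have := cover _ xE; rewrite Tax Txb => /(_ isT) /orP[xF|xF].
    by rewrite (Pr _ jab _ xF jx).
  by rewrite (Qr _ jab _ xF jx) orbT.
- move=> j /andP[j0 jk]; rewrite negb_and; case: (ltnP j b) => jb.
    by rewrite Pc // j0.
  by rewrite (Qc j) ?orbT // jk (leq_trans ab).
Qed.

(** At a knot, two different scalars with full contact would give full contact of
    Q and then of P, so each knot excludes at most one scalar. *)
Theorem contact_free_combination P Q : is_spline P -> is_spline Q ->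
  (forall j, (0 < j < k)%N -> ~~ (contact j (P j) && contact j (Q j))) ->
  exists2 c : R, c != 0 & forall j, (0 < j < k)%N -> ~~ contact j (P j + c *: Q j).
Proof.
move=> sP sQ H.
have [|c c0 Hc] := @generic_scalar R k (fun j c => (0 < j)%N && contact j (P j + c *: Q j)).
  move=> j x y jk /= /andP[j0 cx] /andP[_ cy]; apply/eqP/idPn => xy.
  have := H j; rewrite j0 jk => /(_ isT) /negP; apply.
  have cQ : contact j (Q j).
    have : contact j ((x - y) *: Q j).
      have -> : (x - y) *: Q j = (P j + x *: Q j) - (P j + y *: Q j).
        by rewrite scalerBl opprD addrACA subrr add0r.
      by rewrite /full_contact dvdp_sub.
    by rewrite /full_contact dvdpZr // subr_eq0.
  apply/andP; split => //.
  by move: cx; rewrite /full_contact dvdp_addl // -mul_polyC dvdp_mull.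
by exists c => // j /andP[j0 jk]; have := Hc j jk; rewrite j0.
Qed.

End Witness.

(** * Derivatives of truncated powers *)
Section TruncatedPower.
Context {R : realType}.
Implicit Types (x y : R) (m n s : nat).

Lemma truncated_power_ge m x y : x <= y -> truncated_power m x y = (y - x) ^+ m.
Proof. by move=> xy; rewrite /truncated_power max_l // subr_ge0. Qed.

Lemma truncated_power_le m x y : (0 < m)%N -> y <= x -> truncated_power m x y = 0.
Proof.
by move=> m0 yx; rewrite /truncated_power max_r ?subr_le0 // expr0n gtn_eqF.
Qed.

Lemma continuous_truncated_power m x : continuous (truncated_power m x).
Proof.
move=> y; apply: (@continuous_comp _ _ _ (fun z : R => Num.max (z - x) 0) (fun z => z ^+ m)).
  apply: continuous_max; last exact: cvg_cst.
  by apply: cvgB; [exact: cvg_id | exact: cvg_cst].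
exact: exprn_continuous.
Qed.

Lemma is_derive_truncated_power n x y :
  is_derive y 1 (truncated_power n.+2 x) (n.+2%:R * truncated_power n.+1 x y).
Proof.
case: (ltgtP y x) => [yx|xy|->].
- apply: (near_eq_is_derive (f := cst 0)).
    near=> z; rewrite truncated_power_le // ltW //.
    by near: z; exact: lt_nbhsl.
  rewrite truncated_power_le ?mulr0 ?ltW //; exact: is_derive_cst.
- apply: (near_eq_is_derive (f := (id - cst x) ^+ n.+2)).
    near=> z; rewrite truncated_power_ge; last first.
      by rewrite ltW //; near: z; exact: lt_nbhsr.
    by rewrite exprfctE.
  apply: is_derive_eq.
  by rewrite truncated_power_ge ?ltW // subr0 /GRing.scale /= mulr1.
(* At the kink y = x the difference quotient of order n + 2 is, up to the factor h,
   a truncated power of order n + 1 in h, hence tends to 0. *)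
have lim0 : h^-1 *: (truncated_power n.+2 x (h *: 1 + x) - truncated_power n.+2 x x)
    @[h --> (0 : R)^'] --> (0 : R).
  have := @continuous_truncated_power n.+1 0 0.
  rewrite /continuous_at truncated_power_le // => /cvg_within_filter.
  move=> /(_ (fun h => h != 0)) c0; apply: cvg_trans c0; apply: near_eq_cvg; near=> h.
  have h0 : h != 0 by near: h; exact: nbhs_dnbhs_neq.
  rewrite /= (truncated_power_le (y := x)) // subr0 /GRing.scale /= mulr1.
  case: (leP h 0) => hh.
    by rewrite !truncated_power_le ?mulr0 // gerDr.
  rewrite !truncated_power_ge ?ltW // ?ltrDr // addrK subr0.
  by rewrite [in RHS]exprS mulKf.
rewrite truncated_power_le // mulr0; apply: DeriveDef; last exact: cvg_lim lim0.
by apply/cvg_ex; exists 0.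
Unshelve. all: by end_near.
Qed.

Lemma derive1n_truncated_power m s x y : (s < m)%N ->
  derive1n s (truncated_power m x) y = (m ^_ s)%:R * truncated_power (m - s) x y.
Proof.
elim: s y => [|s IHs] y sm; first by rewrite derive1n0 ffactn0 mul1r subn0.
have fE : derive1n s (truncated_power m x) =
    (m ^_ s)%:R *: (truncated_power (m - s) x : R -> R).
  by apply/funext => z; rewrite IHs // ltnW.
have msE : (m - s = (m - s.+1).-1.+2)%N by lia.
rewrite derive1nS fE derive1E msE.
have d := @is_derive_truncated_power (m - s.+1).-1 x y.
rewrite derive_val ffactnSr natrM -msE /GRing.scale /= mulrA.
by have -> : ((m - s.+1).-1.+1 = m - s.+1)%N by lia.
Qed.

End TruncatedPower.

(** * Divided differences with coincident points *)
Section DividedDifference.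
Context {R : realType}.
Implicit Types (p q g : {poly R}) (y : nat -> R) (i r : nat).

(** Functions of a parameter in T: the variable of the spline in most uses, but also
    a boolean, to compare two functions, or a polynomial, to express linearity. *)
Definition lin_closed (T : Type) (S : set (T -> R)) :=
  [/\ S (fun=> 0), forall f g : T -> R, S f -> S g -> S (fun x => f x + g x) &
      forall (c : R) (f : T -> R), S f -> S (fun x => c * f x)].

Definition window y i r : seq R := [seq y j | j <- iota i r.+1].

Definition ascending y i r := forall a b, (i <= a)%N -> (a <= b <= i + r)%N -> y a <= y b.

Lemma ascending_left y i r : ascending y i r.+1 -> ascending y i r.
Proof. by move=> H a b ia /andP[ab br]; apply: H => //; lia. Qed.

Lemma ascending_right y i r : ascending y i r.+1 -> ascending y i.+1 r.
Proof. by move=> H a b ia /andP[ab br]; apply: H; lia. Qed.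

Lemma windowSl y i r : window y i r.+1 = y i :: window y i.+1 r.
Proof. by []. Qed.

Lemma windowSr y i r : window y i r.+1 = rcons (window y i r) (y (i + r.+1)%N).
Proof. by rewrite /window -addn1 iotaD map_cat /= cats1. Qed.

Lemma confluent_eq y i r j : ascending y i r -> y i = y (i + r)%N ->
  (i <= j <= i + r)%N -> y j = y i.
Proof.
move=> H e /andP[ij jr]; apply/eqP; rewrite eq_le {1}e !H //; lia.
Qed.

Lemma count_confluent y i r : ascending y i r -> y i = y (i + r)%N ->
  count_mem (y i) (window y i r) = r.+1.
Proof.
move=> H e; rewrite -[RHS](size_iota i r.+1) -(size_map y).
apply/eqP; rewrite -all_count; apply/allP => _ /mapP[j + ->].
rewrite mem_iota => Hj; apply/eqP/(confluent_eq H e); lia.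
Qed.

Lemma divided_differenceS (f : R -> R) y i r :
  divided_difference f y i r.+1 =
  if y i == y (i + r.+1)%N then derive1n r.+1 f (y i) / r.+1`!%:R
  else (divided_difference f y i.+1 r - divided_difference f y i r)
       / (y (i + r.+1)%N - y i).
Proof. by []. Qed.

(** A divided difference is a combination of the derivatives of order s at the
    points z, with s less than the number of occurrences of z. Stating this by
    means of an arbitrary S avoids naming the coefficients. *)
Lemma divided_difference_mem (T : Type) (S : set (T -> R)) (F : T -> R -> R) y i r :
  lin_closed S -> ascending y i r ->
  (forall z s, (s < count_mem z (window y i r))%N -> S (fun x => derive1n s (F x) z)) ->
  S (fun x => divided_difference (F x) y i r).
Proof.
move=> [S0 SD SZ]; elim: r i => [|r IHr] i asc HS /=.
  by apply: (HS (y i) 0%N); rewrite /= eqxx.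
case: eqP => [e|_].
  rewrite (_ : (fun x => _) = (fun x => (r.+1`!%:R)^-1 * derive1n r.+1 (F x) (y i))).
    by apply/SZ/HS; rewrite count_confluent.
  by apply/funext => x; rewrite mulrC.
rewrite (_ : (fun x => _) = (fun x => (y (i + r.+1)%N - y i)^-1 *
    (divided_difference (F x) y i.+1 r + (-1) * divided_difference (F x) y i r))).
  apply/SZ/SD.
    apply: IHr; [exact: ascending_right|move=> z s zs; apply: HS].
    by rewrite windowSl (leq_trans zs) // leq_addl.
  apply/SZ/IHr; first exact: ascending_left.
  by move=> z s zs; apply: HS; rewrite windowSr -cats1 count_cat; lia.
by apply/funext => x; rewrite mulrC mulN1r.
Qed.

(** In the recursion only the difference over the last r + 1 points involves the
    last occurrence of the last point, so its weight is a product of nonzero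
    factors. *)
Lemma divided_difference_top (T : Type) (S : set (T -> R)) (F : T -> R -> R) y i r :
  lin_closed S -> ascending y i r ->
  (forall z s, (s < count_mem z (window y i r))%N ->
     (z = y (i + r)%N -> s.+1 < count_mem z (window y i r))%N ->
     S (fun x => derive1n s (F x) z)) ->
  exists2 c, c != 0 & S (fun x => divided_difference (F x) y i r
    - c * derive1n (count_mem (y (i + r)%N) (window y i r)).-1 (F x) (y (i + r)%N)).
Proof.
move=> lS; have [S0 SD SZ] := lS; elim: r i => [|r IHr] i asc HS.
  exists 1; first exact: oner_neq0.
  rewrite addn0; have -> : count_mem (y i) (window y i 0) = 1%N by rewrite /= eqxx.
  by rewrite (_ : (fun x => _) = (fun=> 0)) //; apply/funext => x; rewrite mul1r subrr.
have [e|ne] := eqVneq (y i) (y (i + r.+1)%N).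
  exists (r.+1`!%:R)^-1; first by rewrite invr_eq0 pnatr_eq0 -lt0n fact_gt0.
  rewrite -e count_confluent // (_ : (fun x => _) = (fun=> 0)) //.
  by apply/funext => x /=; case: eqP => // _; rewrite mulrC subrr.
have cE : count_mem (y (i + r.+1)%N) (window y i r.+1) =
    count_mem (y (i + r.+1)%N) (window y i.+1 r) by rewrite windowSl /= (negbTE ne).
have [|z s zs zs'|c c0 Sc] := IHr i.+1; first exact: ascending_right.
  have le : (count_mem z (window y i.+1 r) <= count_mem z (window y i r.+1))%N.
    by rewrite windowSl leq_addl.
  apply: HS; first exact: leq_trans zs le.
  by move=> zE; apply: leq_trans le; apply: zs'; rewrite addSnnS.
exists (c / (y (i + r.+1)%N - y i)).
  by rewrite mulf_neq0 // invr_eq0 subr_eq0 eq_sym.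
rewrite cE; rewrite addSnnS in Sc.
have Sr : S (fun x => divided_difference (F x) y i r).
  apply: divided_difference_mem => //; first exact: ascending_left.
  move=> z s zs; apply: HS; rewrite windowSr -cats1 count_cat; first lia.
  move=> <-; have -> : count_mem z [:: z] = 1%N by rewrite /= eqxx.
  by rewrite addn1.
have := SZ (y (i + r.+1)%N - y i)^-1 _ (SD _ _ Sc (SZ (-1) _ Sr)).
congr S; apply/funext => x /=; rewrite (negbTE ne).
ring.
Qed.

Lemma derive1n_horner s p : derive1n s (horner p) = horner p^`(s).
Proof. by elim: s => [|s IHs]; rewrite ?derive1n0 // derive1nS IHs derivnS derivE. Qed.

Local Notation D p := (divided_difference (horner p)).

Lemma divided_difference_linear y i r : ascending y i r ->
  (forall p q, D (p + q) y i r = D p y i r + D q y i r) /\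
  (forall c p, D (c *: p) y i r = c * D p y i r).
Proof.
pose S : set ({poly R} -> R) := [set h | (forall p q, h (p + q) = h p + h q) /\
  (forall c p, h (c *: p) = c * h p)].
move=> asc; apply: (@divided_difference_mem _ S horner) => //.
  split=> [|f g [fD fZ] [gD gZ]|c f [fD fZ]]; split=> *.
  - by rewrite addr0.
  - by rewrite mulr0.
  - by rewrite fD gD addrACA.
  - by rewrite fZ gZ mulrDr.
  - by rewrite fD mulrDr.
  - by rewrite fZ mulrCA.
move=> z s _; split=> *; rewrite !derive1n_horner.
  by rewrite derivnD hornerD.
by rewrite derivnZ hornerZ.
Qed.

(** When the end points coincide both sides are zero. *)
Lemma divided_difference_step y i r p : ascending y i r.+1 ->
  D p y i r.+1 * (y (i + r.+1)%N - y i) = D p y i.+1 r - D p y i r.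
Proof.
move=> asc; rewrite [D p y i r.+1]/=.
have [e|ne] := eqVneq; last by rewrite divfK // subr_eq0 eq_sym.
have ei : y i.+1 = y i by apply: (confluent_eq asc e); lia.
have er : y (i + r)%N = y i by apply: (confluent_eq asc e); lia.
rewrite -e subrr mulr0; case: r {asc} e er => [|r] e er /=; first by rewrite ei subrr.
by rewrite addSnnS er -e ei eqxx subrr.
Qed.

Lemma derivn_XsubC_mul (a : R) g n :
  (('X - a%:P) * g)^`(n.+1).[a] = n.+1%:R * g^`(n).[a] :> R.
Proof.
have -> : (('X - a%:P) * g)^`(n.+1) = ('X - a%:P) * g^`(n.+1) + g^`(n) *+ n.+1.
  elim: n => [|n IHn]; first by rewrite derivn1 derivM derivXsubC mul1r addrC derivn0 derivn1.
  rewrite derivnS IHn derivD derivM derivXsubC mul1r derivMn -!derivnS.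
  by rewrite [in RHS]mulrS addrCA addrA.
by rewrite !hornerE subrr mul0r add0r hornerMn mulr_natl.
Qed.

(** Leibniz rule for a linear factor that vanishes at the first point. *)
Lemma divided_difference_XsubC y i r g : ascending y i r.+1 ->
  D (('X - (y i)%:P) * g) y i r.+1 = D g y i.+1 r.
Proof.
elim: r i => [|r IHr] i asc.
  rewrite divided_differenceS addn1; case: eqP => [e|/eqP ne].
    by rewrite derive1n_horner derivn_XsubC_mul derivn0 mul1r divr1 e.
  by rewrite /= !hornerE subrr mul0r subr0 mulrAC divff ?mul1r // subr_eq0 eq_sym.
have [e|ne] := eqVneq (y i) (y (i + r.+2)%N).
  have ei : y i.+1 = y i by apply: (confluent_eq asc e); lia.
  rewrite !divided_differenceS ei -e addSnnS -e eqxx !derive1n_horner derivn_XsubC_mul.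
  rewrite factS natrM invfM mulrACA divff ?mul1r // pnatr_eq0 //.
have asc' := ascending_right asc; have asc1 := ascending_left asc.
have [DD DZ] := divided_difference_linear asc'.
rewrite [LHS]divided_differenceS (negbTE ne) (IHr i asc1).
have -> : ('X - (y i)%:P) * g = ('X - (y i.+1)%:P) * g + (y i.+1 - y i) *: g.
  by rewrite -mul_polyC polyCB -mulrDl addrA subrK.
rewrite DD DZ IHr //; have := divided_difference_step g asc'; rewrite addSnnS => st.
apply: (@mulIf _ (y (i + r.+2)%N - y i)); first by rewrite subr_eq0 eq_sym.
rewrite divfK ?subr_eq0 1?eq_sym //.
move: st; move: (D g y i.+2 r) (D g y i.+1 r) (D g y i.+1 r.+1) => A B C; lra.
Qed.

Lemma divided_differenceC y i r c : ascending y i r ->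
  D c%:P y i r = c *+ (r == 0%N).
Proof.
elim: r i => [|r IHr] i asc; first by rewrite /= hornerC.
rewrite divided_differenceS; case: eqP => _; last first.
  by rewrite !IHr ?subrr ?mul0r //; [exact: ascending_left | exact: ascending_right].
by rewrite derive1n_horner derivnC horner0 mul0r.
Qed.

(** Write p = (X - y i) g + p(y i) and peel off one point. *)
Theorem divided_difference_poly y i r p : ascending y i r -> (size p <= r)%N ->
  D p y i r = 0.
Proof.
elim: r i p => [|r IHr] i p asc sp.
  by move: sp; rewrite leqn0 size_poly_eq0 => /eqP ->; rewrite /= horner0.
have /factor_theorem[g gE] : root (p - p.[y i]%:P) (y i).
  by rewrite /root !hornerE subrr.
have -> : p = ('X - (y i)%:P) * g + p.[y i]%:P by rewrite mulrC -gE subrK.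
rewrite (divided_difference_linear asc).1 divided_difference_XsubC // divided_differenceC //.
rewrite addr0 IHr //; first exact: ascending_right.
have [->|g0] := eqVneq g 0; first by rewrite size_poly0.
have : (size (g * ('X - (y i)%:P))%R <= r.+1)%N.
  rewrite -gE (leq_trans (size_polyD _ _)) // geq_max sp size_polyN size_polyC.
  by case: (_ != 0).
by rewrite size_Mmonic ?monicXsubC // size_XsubC addn2.
Qed.

End DividedDifference.

(** * Sequences with repetitions *)
Section Runs.
Context {R : realType}.
Implicit Types (c : nat -> nat) (v : nat -> R).

Definition runs c v n : seq R := flatten [seq nseq (c j) (v j) | j <- iota 0 n].

Lemma runsS c v n : runs c v n.+1 = runs c v n ++ nseq (c n) (v n).
Proof. by rewrite /runs -addn1 iotaD map_cat flatten_cat /= cats0. Qed.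

Lemma size_runs c v n : size (runs c v n) = (\sum_(0 <= j < n) c j)%N.
Proof.
elim: n => [|n IHn]; first by rewrite big_geq.
by rewrite runsS size_cat size_nseq IHn big_nat_recr.
Qed.

Lemma mem_runs c v n x : x \in runs c v n -> exists2 j, (j < n)%N & x = v j.
Proof.
move=> /flattenP[_ /mapP[j + ->]]; rewrite mem_iota mem_nseq => /andP[_ jn].
by move=> /andP[_ /eqP ->]; exists j.
Qed.

Lemma count_runs c v n p : injective v ->
  count_mem (v p) (runs c v n) = if (p < n)%N then c p else 0%N.
Proof.
move=> vI; elim: n => // n IHn; rewrite runsS count_cat IHn count_nseq /=.
rewrite (inj_eq vI) ltnS; case: ltngtP => [//|//|->] /=; lia.
Qed.

Lemma sorted_runs c v n : {homo v : a b / (a <= b)%N >-> a <= b} ->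
  sorted <=%R (runs c v n).
Proof.
move=> vH; rewrite sorted_pairwise; last exact: le_trans.
elim: n => // n IHn; rewrite runsS pairwise_cat IHn /=; apply/andP; split.
  apply/allrelP => x y /mem_runs[j jn ->]; rewrite mem_nseq => /andP[_ /eqP ->].
  exact/vH/ltnW.
by elim: (c n) => //= d ->; rewrite andbT; apply/allP => x; rewrite mem_nseq => /andP[_ /eqP ->].
Qed.

End Runs.

(** * Spaces containing many powers of linear functions *)
Section LinClosed.
Context {R : realType}.

Lemma lin_closed_sum (T I : Type) (S : set (T -> R)) (s : seq I) (P : pred I)
    (F : I -> T -> R) : lin_closed S ->
  (forall i, P i -> S (F i)) -> S (fun x => \sum_(i <- s | P i) F i x).
Proof.
move=> [S0 SD SZ] HF; elim: s => [|i s IHs].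
  by rewrite (_ : (fun x => _) = (fun=> 0)) //; apply/funext => x; rewrite big_nil.
have [Pi|nPi] := boolP (P i).
  rewrite (_ : (fun x => _) = (fun x => F i x + \sum_(j <- s | P j) F j x)).
    exact: SD (HF _ Pi) IHs.
  by apply/funext => x; rewrite big_cons Pi.
rewrite (_ : (fun x => _) = (fun x => \sum_(j <- s | P j) F j x)) //.
by apply/funext => x; rewrite big_cons (negbTE nPi).
Qed.

Lemma coef_XsubC_exp (m r : nat) (x : R) : (r <= m)%N ->
  (('X - x%:P) ^+ m)`_r = (- x) ^+ (m - r) *+ 'C(m, r).
Proof.
move=> rm; rewrite addrC exprDn coef_sum (bigD1 (Ordinal (rm : (r < m.+1)%N))) //=.
rewrite big1 ?addr0 => [|i ir].
  by rewrite coefMn -polyCN -polyC_exp coefCM coefXn eqxx mulr1.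
rewrite coefMn -polyCN -polyC_exp coefCM coefXn.
have -> : (r == i)%N = false by apply: contraNF ir => /eqP e; apply/eqP/val_inj.
by rewrite mulr0 mul0rn.
Qed.

(** Lagrange interpolation in y at the nodes tau q reproduces (y - x)^m. Comparing
    coefficients of y^(m - r) expresses x^r as a combination of the functions
    (tau q - x)^m. *)
Lemma polynomials_of_powers (m : nat) (tau : nat -> R) (S : set (R -> R)) :
  lin_closed S -> injective tau -> (forall q, S (fun x => (tau q - x) ^+ m)) ->
  forall p : {poly R}, (size p <= m.+1)%N -> S (horner p).
Proof.
move=> lS tI HS; have [S0 SD SZ] := lS.
pose zs := [seq tau q | q <- iota 0 m.+1].
have uzs : uniq zs by rewrite map_inj_uniq ?iota_uniq.
have szs : size zs = m.+1 by rewrite size_map size_iota.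
have /choice[ell Hell] q : exists p : {poly R}, (size p <= m.+1)%N /\
    {in zs, forall z, p.[z] = (z == tau q)%:R}.
  by have [p sp Hp] := interpolation (fun z => (z == tau q)%:R) uzs; exists p; rewrite -szs.
have key x : \sum_(q < m.+1) ((tau q - x) ^+ m) *: ell q = ('X - x%:P) ^+ m.
  apply/eqP; rewrite -subr_eq0; apply/eqP/(roots_geq_poly_eq0 _ uzs); last first.
    rewrite szs (leq_trans (size_polyD _ _)) // geq_max size_polyN size_exp_XsubC leqnn andbT.
    apply: (leq_trans (size_sum _ _ _)); apply/bigmax_leqP => q _.
    by rewrite (leq_trans (size_scale_leq _ _)) //; case: (Hell q).
  apply/allP => _ /mapP[p + ->]; rewrite mem_iota => /andP[_ pm]; rewrite add0n in pm.
  rewrite /root hornerD hornerN horner_exp hornerXsubC horner_sum subr_eq0.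
  rewrite (bigD1 (Ordinal pm)) //= big1 ?addr0 => [|q qp]; rewrite hornerZ.
    by rewrite (Hell p).2 ?eqxx ?mulr1 // map_f // mem_iota.
  rewrite (Hell q).2 ?map_f ?mem_iota // (inj_eq tI) (_ : (p == q)%N = false) ?mulr0 //.
  by apply: contraNF qp => /eqP e; apply/eqP/val_inj.
have Spow r : (r <= m)%N -> S (fun x => x ^+ r).
  move=> rm; pose a := (-1) ^+ r / ('C(m, r))%:R : R.
  rewrite (_ : (fun x => _) = (fun x => a * \sum_(q <- enum 'I_m.+1)
      (ell q)`_(m - r) * (tau q - x) ^+ m)).
    by apply: (SZ); apply: lin_closed_sum => // q _; apply: (SZ).
  apply/funext => x; rewrite big_enum /=.
  have := congr1 (fun p : {poly R} => p`_(m - r)) (key x).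
  rewrite coef_sum coef_XsubC_exp ?leq_subr // subKn // bin_sub //.
  rewrite (eq_bigr (fun q : 'I_m.+1 => (ell q)`_(m - r) * (tau q - x) ^+ m)); last first.
    by move=> q _; rewrite coefZ mulrC.
  move=> ->; have -> : (- x) ^+ r = (-1) ^+ r * x ^+ r by exact: exprNn.
  rewrite /a -[_ *+ _]mulr_natr.
  have C0 : ('C(m, r))%:R != 0 :> R by rewrite pnatr_eq0 -lt0n bin_gt0.
  have s1 : (-1) ^+ r * (-1) ^+ r = 1 :> R by rewrite -exprMn mulrNN mulr1 expr1n.
  transitivity ((-1) ^+ r * (-1) ^+ r * x ^+ r); first by rewrite s1 mul1r.
  by move: C0 (_ ^+ r) (x ^+ r) => C0 u v; field.
move=> p sp; rewrite (_ : horner p = fun x => \sum_(i <- enum 'I_(size p)) p`_i * x ^+ i).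
  apply: lin_closed_sum => // i _; apply: (SZ); apply: Spow.
  by rewrite -ltnS (leq_trans (ltn_ord i)).
by apply/funext => x; rewrite big_enum horner_coef.
Qed.

End LinClosed.

Lemma poly0_on_interval (R : numFieldType) (a b : R) (p : {poly R}) : a < b ->
  (forall x, a <= x <= b -> p.[x] = 0) -> p = 0.
Proof.
move=> ab H; pose f (i : nat) : R := a + (b - a) / i.+1%:R.
have ba : 0 < b - a by rewrite subr_gt0.
apply: (@roots_geq_poly_eq0 _ p [seq f i | i <- iota 0 (size p)]).
- apply/allP => _ /mapP[i _ ->]; apply/eqP/H; apply/andP; split.
    by rewrite lerDl divr_ge0 // ltW.
  by rewrite -lerBrDl ler_pdivrMr ?ltr0Sn //; apply: ler_peMr; [exact: ltW | rewrite ler1n].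
- rewrite map_inj_uniq ?iota_uniq // => i j /addrI /(mulfI (lt0r_neq0 ba)) /invr_inj /eqP.
  by rewrite eqr_nat => /eqP[].
- by rewrite size_map size_iota.
Qed.

(** * Knots of a B-spline *)
Section SplinesOnInterval.
Context {R : realType} (m k : nat) (t : int -> R) (mu : int -> nat).
Hypothesis hm : (1 <= m)%N.
Hypothesis hk : (1 <= k)%N.
Hypothesis ht : forall i : int, t i < t (i + 1).
Hypothesis hmu : forall i : int, (1 <= mu i <= m)%N.
Local Notation last_mult := (last_mult m mu).
Local Notation knot_span := (knot_span m mu).
Local Notation knots := (knots m t mu).
Local Notation Q := (Q m t mu).

Lemma t_ltD i n : t i < t (i + n.+1%:Z).
Proof.
elim: n => [|n IHn]; first exact: ht.
by apply: (lt_trans IHn); rewrite -[n.+2]addn1 PoszD addrA; apply: ht.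
Qed.

Lemma t_lt i j : i < j -> t i < t j.
Proof.
move=> ij; have -> : j = i + (`|j - i|%N.-1.+1)%:Z by lia.
exact: t_ltD.
Qed.

Lemma t_le i j : i <= j -> t i <= t j.
Proof. by rewrite le_eqVlt => /orP[/eqP -> //|/t_lt/ltW]. Qed.

Lemma t_inj : injective t.
Proof.
by move=> i j e; case: (ltgtP i j) => // /t_lt; rewrite e ltxx.
Qed.

Lemma sum_mu_ge i n : (n <= \sum_(1 <= j < n.+1) mu (i + j%:Z)%R)%N.
Proof.
elim: n => // n IHn; rewrite big_nat_recr //=.
by rewrite -[X in (X <= _)%N]addn1 leq_add //; case/andP: (hmu (i + n.+1%:Z)).
Qed.

(** The property by which knot_span is chosen. *)
Definition valid_span i l n := (1 <= n)%N /\ (1 <= last_mult i l n <= mu (i + n%:Z)%R)%N.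

Lemma valid_span_uniq i l n n' : valid_span i l n -> valid_span i l n' -> n = n'.
Proof.
have le a b : valid_span i l a -> valid_span i l b -> (a <= b)%N.
  move=> [a1 Ha] [b1 Hb]; rewrite leqNgt; apply/negP => ba.
  move: Ha Hb; rewrite /Defs.last_mult (big_cat_nat (n := b.+1) (p := a)) //=.
  rewrite big_nat_recr //=; lia.
by move=> Hn Hn'; apply/eqP; rewrite eqn_leq !le.
Qed.

Lemma knot_spanP i l : (1 <= l <= mu i)%N -> valid_span i l (knot_span i l).
Proof.
move=> Hl; apply: (@xgetPex _ 1%N [set n | valid_span i l n]).
have ex : exists n, (m + 2 <= l + \sum_(1 <= j < n.+1) mu (i + j%:Z)%R)%N.
  by exists (m + 2)%N; have := sum_mu_ge i (m + 2); lia.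
case: (ex_minnP ex) => [[|n]] Hn Hmin.
  by have := hmu i; move: Hn; rewrite big_geq //; lia.
exists n.+1; split => //; rewrite /Defs.last_mult.
have := Hmin n; move: Hn; rewrite big_nat_recr //=; lia.
Qed.

Lemma knot_span_eq i l n : (1 <= l <= mu i)%N -> valid_span i l n -> knot_span i l = n.
Proof. by move=> Hl; apply: valid_span_uniq; apply: knot_spanP. Qed.

Section OneWindow.
Variables (i : int) (l : nat).
Hypothesis Hl : (1 <= l <= mu i)%N.
Let n := knot_span i l.
Let e := last_mult i l n.
(* the number of times that t (i + j) occurs among the knots of Q i l *)
Let c j := if j == 0%N then l else if j == n then e else mu (i + j%:Z)%R.

Lemma knots_runs : knots i l = runs c (fun j => t (i + j%:Z)) n.+1.
Proof.
have [n1 _] := knot_spanP Hl; rewrite -/n in n1.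
rewrite /Defs.knots -/n -/e runsS {2}/c eqxx gtn_eqF // catA; congr (_ ++ _).
rewrite /runs -(prednK n1) /= addr0; congr (_ ++ flatten _).
rewrite /index_iota prednK // subn1; apply/eq_in_map => j; rewrite mem_iota => Hj.
by rewrite /c gtn_eqF ?ltn_eqF //; lia.
Qed.

Lemma size_knots : size (knots i l) = m.+2.
Proof.
have [n1 He] := knot_spanP Hl; rewrite -/n -/e in n1 He.
rewrite knots_runs size_runs big_nat_recr //= big_ltn // {1 3}/c eqxx gtn_eqF //.
rewrite (eq_big_nat _ _ (F2 := fun j => mu (i + j%:Z)%R)).
  by move: He; rewrite /e /Defs.last_mult eqxx; lia.
by move=> j Hj; rewrite /c gtn_eqF ?ltn_eqF //; lia.
Qed.

Lemma knot_span_le : (n <= m.+1)%N.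
Proof.
have [n1 He] := knot_spanP Hl; rewrite -/n -/e in n1 He.
have := sum_mu_ge i n.-1; rewrite prednK //.
by move: He; rewrite /e /Defs.last_mult; lia.
Qed.

Lemma ascending_knots : ascending (nth 0 (knots i l)) 0 m.+1.
Proof.
move=> a b _ /andP[ab bm].
have srt : sorted <=%R (knots i l).
  rewrite knots_runs sorted_runs // => p q pq; apply: t_le; lia.
apply: (sorted_leq_nth le_trans lexx 0 srt) => //; rewrite inE size_knots; lia.
Qed.

Lemma window_knots : window (nth 0 (knots i l)) 0 m.+1 = knots i l.
Proof. by rewrite /window -size_knots map_nth_iota0 // take_size. Qed.

Lemma mem_knots z : z \in knots i l -> exists2 j, (j <= n)%N & z = t (i + j%:Z).
Proof. by rewrite knots_runs => /mem_runs[j jn ->]; exists j. Qed.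

Lemma count_knots j : count_mem (t (i + j%:Z)) (knots i l) = if (j <= n)%N then c j else 0%N.
Proof.
rewrite knots_runs (@count_runs R c (fun j => t (i + j%:Z))) => [|p q /t_inj].
  by rewrite ltnS.
lia.
Qed.

Lemma count_knots_le j : (count_mem (t (i + j%:Z)) (knots i l) <= mu (i + j%:Z)%R)%N.
Proof.
rewrite count_knots; case: ifP => // _; rewrite /c; case: eqP => [->|_].
  by rewrite addr0; case/andP: Hl.
by case: eqP => [->|//]; have [_ /andP[]] := knot_spanP Hl.
Qed.

Lemma last_knot : nth 0 (knots i l) m.+1 = t (i + n%:Z).
Proof.
have [n1 He] := knot_spanP Hl; rewrite -/n -/e in n1 He.
have -> : m.+1 = (size (knots i l)).-1 by rewrite size_knots.
rewrite nth_last knots_runs runsS last_cat {2}/c eqxx gtn_eqF //.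
by case: e He => // e' _ /=; elim: e'.
Qed.

Lemma window_jet z s : (s < count_mem z (knots i l))%N ->
  exists j, [/\ i <= j <= i + n%:Z, z = t j & (s < mu j)%N].
Proof.
move=> zs; have /mem_knots[j jn zE] : z \in knots i l by rewrite -has_pred1 has_count; lia.
exists (i + j%:Z); split => //; first lia.
by rewrite (leq_trans zs) // zE count_knots_le.
Qed.

Lemma Q_mem (S : set (R -> R)) : lin_closed S ->
  (forall j s, i <= j <= i + n%:Z -> (s < mu j)%N ->
     S (fun x => derive1n s (truncated_power m x) (t j))) -> S (Q i l).
Proof.
move=> lS HS; apply: divided_difference_mem => //; first exact: ascending_knots.
by move=> z s; rewrite window_knots => /window_jet[j [ij -> sj]]; apply: HS.
Qed.

Lemma Q_top (S : set (R -> R)) : lin_closed S ->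
  (forall j s, i <= j <= i + n%:Z -> (s < mu j)%N -> (j = i + n%:Z -> (s.+1 < e)%N) ->
     S (fun x => derive1n s (truncated_power m x) (t j))) ->
  exists2 a, a != 0 & S (fun x => Q i l x -
    a * derive1n e.-1 (truncated_power m x) (t (i + n%:Z))).
Proof.
move=> lS HS; have [n1 He] := knot_spanP Hl; rewrite -/n -/e in n1 He.
have ce : count_mem (t (i + n%:Z)) (knots i l) = e.
  by rewrite count_knots leqnn /c eqxx gtn_eqF.
have [|a a0] := @divided_difference_top _ _ S (truncated_power m) _ _ _ lS ascending_knots.
  move=> z s; rewrite window_knots last_knot => zs zs'.
  have [j [ij zE sj]] := window_jet zs; rewrite zE; apply: HS => // jE.
  by rewrite -ce -jE -zE; apply: zs'; rewrite zE jE.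
by rewrite window_knots last_knot ce; exists a.
Qed.

End OneWindow.

(** Truncated powers vanish to the right of their knot. *)
Lemma Q_right i l x : (1 <= l <= mu i)%N -> t (i + m.+1%:Z) <= x -> Q i l x = 0.
Proof.
move=> Hl tx; apply: (@Q_mem i l Hl [set f | f x = 0]).
  by split=> [//|f g /= -> ->|c f /= ->]; rewrite ?addr0 ?mulr0.
move=> j s /andP[_ jn] sj /=; have mj := hmu j.
rewrite derive1n_truncated_power; last lia.
rewrite truncated_power_le ?mulr0 //; [lia|].
by apply: le_trans tx; apply: t_le; have := knot_span_le Hl; lia.
Qed.

Lemma derivn_XsubC_exp (x : R) s :
  (('X - x%:P) ^+ m)^`(s) = (m ^_ s)%:R *: ('X - x%:P) ^+ (m - s).
Proof.
elim: s => [|s IHs]; first by rewrite derivn0 ffactn0 scale1r subn0.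
rewrite derivnS IHs derivZ deriv_exp derivXsubC mul1r ffactnSr natrM -scalerA.
by congr (_ *: _); rewrite scaler_nat subnS.
Qed.

(** To the left of all knots the truncated power has the same derivatives at the
    knots as the polynomial (y - x)^m of degree m, and a divided difference of
    order m + 1 kills it. *)
Lemma Q_left i l x : (1 <= l <= mu i)%N -> x <= t i -> Q i l x = 0.
Proof.
move=> Hl xt; pose S : set (bool -> R) := [set h | h true = h false].
pose F b := if b then truncated_power m x else horner (('X - x%:P) ^+ m).
pose y := nth 0 (knots i l); have asc := ascending_knots Hl.
transitivity (divided_difference (F false) y 0 m.+1); last first.
  by apply: divided_difference_poly => //; rewrite size_exp_XsubC.
apply: (@divided_difference_mem _ _ S F) => //.
  by split=> [//|f g fE gE|c f fE]; [exact: (congr2 +%R fE gE) | exact: (congr1 ( *%R c) fE)].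
move=> z s; rewrite window_knots // => /(window_jet Hl)[j [/andP[ij _] -> sj]].
have mj := hmu j; change (derive1n s (truncated_power m x) (t j) =
  derive1n s (horner (('X - x%:P) ^+ m)) (t j)).
rewrite derive1n_horner derivn_XsubC_exp hornerZ horner_exp hornerXsubC.
rewrite derive1n_truncated_power; last lia.
by rewrite truncated_power_ge // (le_trans xt) // t_le.
Qed.

(** * Combinations of B-splines on the interval *)
Definition on_interval (x : R) := t 0 <= x <= t k%:Z.

Definition in_spline_space (g : R -> R) :=
  exists2 f, spline_space m t mu f & forall x, on_interval x -> f x = g x.

(** Outside this range Q i l vanishes on [t 0, t k]. *)
Definition indices : seq int := [seq n%:Z - m.+1%:Z | n <- iota 0 (m + k + 2)].

Definition spline_sum (c : int -> nat -> R) x :=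
  \sum_(i <- indices) \sum_(1 <= l < (mu i).+1) c i l * Q i l x.

Lemma uniq_indices : uniq indices.
Proof. by rewrite map_inj_uniq ?iota_uniq // => i j; lia. Qed.

Lemma mem_indices i : (i \in indices) = (- m.+1%:Z <= i <= k%:Z).
Proof.
apply/mapP/idP => [[n + ->]|Hi]; first by rewrite mem_iota; lia.
by exists `|(i + m.+1%:Z)%R|%N; rewrite ?mem_iota; lia.
Qed.

Lemma Q_outside i l x : i \notin indices -> (1 <= l < (mu i).+1)%N ->
  on_interval x -> Q i l x = 0.
Proof.
rewrite mem_indices => Hi Hl /andP[x0 xk].
case: (ltP i (- m.+1%:Z)) => Hi'.
  by apply: Q_right => //; apply: le_trans x0; apply: t_le; lia.
by apply: Q_left => //; apply: le_trans xk _; apply: t_le; lia.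
Qed.

(** Dropping the terms that vanish on the interval turns the locally finite sums
    into finite ones, which makes the space visibly linear. *)
Lemma in_spline_spaceP g : in_spline_space g <->
  exists c, forall x, on_interval x -> g x = spline_sum c x.
Proof.
split=> [[f [c fE] fg]|[c gE]].
  exists c => x xI; rewrite -fg // fE (fsbigE _ _ uniq_indices) //.
    by apply: eq_bigl => i; rewrite in_setT.
  move=> i _ ni; rewrite big_nat_cond big1 // => l /andP[Hl _].
  by rewrite Q_outside ?mulr0.
pose c' i l := if i \in indices then c i l else 0.
exists (spline_sum c); last by move=> x xI; rewrite gE.
exists c' => x; rewrite (fsbigE _ _ uniq_indices) //.
  rewrite /spline_sum [RHS]big_mkcond; apply: eq_big_seq => i Hi; rewrite in_setT.
  by apply: eq_bigr => l _; rewrite /c' Hi.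
by move=> i _ ni; rewrite big1 // => l _; rewrite /c' (negbTE ni) mul0r.
Qed.

Lemma in_spline_space_ext g h : (forall x, on_interval x -> g x = h x) ->
  in_spline_space g -> in_spline_space h.
Proof. by move=> gh [f fS fg]; exists f => // x xI; rewrite fg // gh. Qed.

Lemma in_spline_space_closed : lin_closed in_spline_space.
Proof.
split=> [|f g /in_spline_spaceP[c fE] /in_spline_spaceP[d gE]|a f /in_spline_spaceP[c fE]];
  apply/in_spline_spaceP.
- exists (fun _ _ => 0) => x _; rewrite /spline_sum big1 // => i _.
  by rewrite big1 // => l _; rewrite mul0r.
- exists (fun i l => c i l + d i l) => x xI; rewrite fE // gE // /spline_sum.
  rewrite -big_split; apply: eq_bigr => i _ /=; rewrite -big_split.
  by apply: eq_bigr => l _; rewrite mulrDl.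
- exists (fun i l => a * c i l) => x xI; rewrite fE // /spline_sum mulr_sumr.
  apply: eq_bigr => i _; rewrite mulr_sumr.
  by apply: eq_bigr => l _; rewrite mulrA.
Qed.

Lemma in_spline_space_Q i l : (1 <= l <= mu i)%N -> in_spline_space (Q i l).
Proof.
move=> Hl; have [ii|ni] := boolP (i \in indices); last first.
  apply: (in_spline_space_ext (g := fun=> 0)); last by case: in_spline_space_closed.
  by move=> x xI; rewrite Q_outside.
apply/in_spline_spaceP; exists (fun i' l' => ((i' == i) && (l' == l))%:R) => x _.
rewrite /spline_sum (bigD1_seq i) ?uniq_indices //= [X in _ + X]big1 => [|j ji].
  rewrite addr0 (bigD1_seq l) ?iota_uniq ?mem_index_iota //= !eqxx mul1r.
  by rewrite big1 ?addr0 // => l' l'l; rewrite (negbTE l'l) mul0r.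
by rewrite big1 // => l' _; rewrite (negbTE ji) mul0r.
Qed.

(** The elementary splines: up to a factor, the truncated powers (t j - x)_+^(m - s),
    of which divided differences are combinations. *)
Definition knot_function (j : int) (s : nat) : R -> R :=
  fun x => derive1n s (truncated_power m x) (t j).

Lemma knot_functionE j s x : (s < mu j)%N ->
  knot_function j s x = (m ^_ s)%:R * truncated_power (m - s) x (t j).
Proof. by move=> sj; apply: derive1n_truncated_power; have := hmu j; lia. Qed.

Lemma knot_function_left j s x : (s < mu j)%N -> t j <= x -> knot_function j s x = 0.
Proof.
move=> sj jx; rewrite knot_functionE // truncated_power_le ?mulr0 //.
by have := hmu j; lia.
Qed.

(** The first m + 2 knots met when going left from copy s + 1 of t j are the knots of
    a B-spline, so that copy is the last knot of it. *)
Lemma window_ending_at j s : (s < mu j)%N ->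
  exists i l, [/\ (1 <= l <= mu i)%N, i + (knot_span i l)%:Z = j &
    last_mult i l (knot_span i l) = s.+1].
Proof.
move=> sj; pose sig n := (\sum_(1 <= q < n) mu (j - q%:Z)%R)%N.
have sig_ge n : (n <= sig n.+1)%N.
  elim: n => // n IHn; rewrite /sig big_nat_recr //= -/(sig n.+1).
  by rewrite -[X in (X <= _)%N]addn1 leq_add //; case/andP: (hmu (j - n.+1%:Z)).
have ex : exists n, (m + 2 <= s.+1 + sig n.+1)%N.
  by exists (m + 2)%N; have := sig_ge (m + 2)%N; lia.
case: (ex_minnP ex) => [[|n]] Hn Hmin.
  by have := hmu j; move: Hn; rewrite /sig big_geq //; lia.
pose i := j - n.+1%:Z; pose l := (m + 2 - (s.+1 + sig n.+1))%N.
have sumE : (\sum_(1 <= q < n.+1) mu (i + q%:Z)%R = sig n.+1)%N.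
  rewrite big_nat_rev /sig; apply: eq_big_nat => q Hq; congr mu; rewrite /i; lia.
have Hl : (1 <= l <= mu i)%N.
  have := Hmin n; move: Hn; rewrite /sig big_nat_recr //= -/(sig n.+1) /l /i; lia.
have e1 : last_mult i l n.+1 = s.+1.
  by rewrite /Defs.last_mult sumE; move: Hl; rewrite /l; lia.
have e2 : i + n.+1%:Z = j by rewrite /i; lia.
have vs : valid_span i l n.+1 by split => //; rewrite e1 e2.
by exists i, l; rewrite (knot_span_eq Hl vs) e1 e2.
Qed.

(** Induction from the left: those of knots at or before t 0 vanish on the interval,
    and Q_top expresses every other one by a B-spline and earlier ones. *)
Lemma in_spline_space_knot_function j s : (s < mu j)%N ->
  in_spline_space (knot_function j s).
Proof.
have [S0 SD SZ] := in_spline_space_closed.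
have left_knot j' s' : j' <= 0 -> (s' < mu j')%N -> in_spline_space (knot_function j' s').
  move=> j0 sj; apply: (in_spline_space_ext (g := fun=> 0)) => // x /andP[x0 _].
  by rewrite knot_function_left // (le_trans _ x0) // t_le.
case: (leP j 0) => j0; first exact: left_knot.
have {j0} [n] := ubnP `|j|%N; elim: n j s => // n IHn j s jn.
elim: {s}s.+1 {-2}s (ltnSn s) => // b IHb s; rewrite ltnS => sb sj.
have [i [l [Hl ij ls]]] := window_ending_at sj.
have [|c c0] := Q_top Hl in_spline_space_closed.
  move=> j' s' /andP[ij' j'j] s'j'; rewrite ij ls => H.
  case: (leP j' 0) => j'0; first exact: left_knot.
  have [j'E|nj] := eqVneq j' j; last by apply: IHn => //; lia.
  by rewrite j'E; apply: IHb; [have := H j'E; lia | rewrite -j'E].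
rewrite ij ls /= => H.
apply: (in_spline_space_ext (g := fun x => c^-1 * (Q i l x + (-1) *
  (Q i l x - c * knot_function j s x)))).
  by move=> x _; rewrite mulN1r opprB addrC subrK mulKf.
by apply/SZ/SD; [exact: in_spline_space_Q | exact: SZ].
Qed.

(** * B-splines span all splines *)

(** The end knots are moved outwards so that all samples are strictly between the
    first and the last one, and get multiplicity m + 1, so that contact there is
    no condition. *)
Definition ext_knot (j : nat) : R :=
  if j == 0%N then t 0 - 1 else if j == k then t k%:Z + 1 else t j%:Z.

Definition ext_mult (j : nat) : nat :=
  if (j == 0%N) || (j == k) then m.+1 else mu j%:Z.

Local Notation T := ext_knot.
Local Notation rho := ext_mult.
Local Notation contact := (full_contact m T rho).
Local Notation is_spline := (is_spline m k T rho).

Lemma ext_knotE j : (0 < j < k)%N -> T j = t j%:Z.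
Proof. by move=> Hj; rewrite /T gtn_eqF ?ltn_eqF //; case/andP: Hj. Qed.

Lemma ext_multE j : (0 < j < k)%N -> rho j = mu j%:Z.
Proof. by move=> Hj; rewrite /rho gtn_eqF ?ltn_eqF //; case/andP: Hj. Qed.

Lemma ext_mult0 : rho 0 = m.+1. Proof. by []. Qed.

Lemma ext_multk : rho k = m.+1.
Proof. by rewrite /rho eqxx orbT. Qed.

Lemma ext_multP j : (0 < j < k)%N -> (1 <= rho j <= m)%N.
Proof. by move=> Hj; rewrite ext_multE. Qed.

Lemma ext_knot_le j : (j < k)%N -> T j <= t j%:Z.
Proof.
move=> jk; case: (posnP j) => [->|j0]; first by rewrite /T /= gerDl lerN10.
by rewrite ext_knotE // j0.
Qed.

Lemma ext_knot_ge j : (0 < j <= k)%N -> t j%:Z <= T j.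
Proof.
move=> /andP[j0]; rewrite leq_eqVlt => /orP[/eqP ->|jk].
  by rewrite /T gtn_eqF // eqxx lerDl ler01.
by rewrite ext_knotE // j0.
Qed.

Lemma ext_knot_lt j : (j < k)%N -> T j < T j.+1.
Proof.
move=> jk; apply: le_lt_trans (ext_knot_le jk) _.
by apply: lt_le_trans (ext_knot_ge (j := j.+1) jk); apply: t_lt; lia.
Qed.

Lemma on_interval_ext x : on_interval x -> T 0 < x < T k.
Proof.
move=> /andP[x0 xk]; rewrite /T eqxx gtn_eqF //= eqxx.
by apply/andP; split; lra.
Qed.

Lemma piece_exists x : on_interval x -> exists2 j, (j < k)%N & T j <= x <= T j.+1.
Proof.
move=> /on_interval_ext /andP[/ltW x0 /ltW xk].
have : forall n, T 0 <= x <= T n.+1 -> exists2 j, (j < n.+1)%N & T j <= x <= T j.+1.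
  elim=> [|n IHn] /andP[_ xn]; first by exists 0%N; rewrite ?x0.
  case: (leP x (T n.+1)) => xn'; last by exists n.+1; rewrite ?xn ?ltW.
  by have [|j jn xj] := IHn; [rewrite x0 | exists j => //; apply: ltnW].
by move=> /(_ k.-1); rewrite prednK //; apply; rewrite x0.
Qed.

Lemma piece_points j x : (j < k)%N -> t j%:Z <= x <= t j.+1%:Z ->
  on_interval x /\ T j <= x <= T j.+1.
Proof.
move=> jk /andP[jx xj]; split.
  by rewrite /on_interval (le_trans _ jx) ?(le_trans xj) // t_le //; lia.
by rewrite (le_trans (ext_knot_le jk)) // (le_trans xj) // ext_knot_ge.
Qed.

Lemma is_splineD P1 P2 : is_spline P1 -> is_spline P2 ->
  is_spline (fun j => P1 j + P2 j).
Proof.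
move=> [s1 d1] [s2 d2]; split=> j jk.
  by rewrite (leq_trans (size_polyD _ _)) // geq_max s1 // s2.
by rewrite opprD addrACA /full_contact dvdp_add //; [exact: d1 | exact: d2].
Qed.

Lemma is_splineZ c P : is_spline P -> is_spline (fun j => c *: P j).
Proof.
move=> [s1 d1]; split=> j jk; first by rewrite (leq_trans (size_scale_leq _ _)) //; apply: s1.
by rewrite -scalerBr /full_contact -mul_polyC dvdp_mull //; apply: d1.
Qed.

Definition agrees (P : nat -> {poly R}) (g : R -> R) :=
  forall j x, (j < k)%N -> on_interval x -> T j <= x <= T j.+1 -> g x = (P j).[x].

Definition piecewise (g : R -> R) := exists2 P, is_spline P & agrees P g.

Lemma piecewise_closed : lin_closed piecewise.
Proof.
split=> [|f g [P sP Pf] [P' sP' Pg]|c f [P sP Pf]].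
- exists (fun=> 0) => [|j x _ _ _]; last by rewrite horner0.
  by split=> j _; rewrite ?size_poly0 // subrr /full_contact dvdp0.
- exists (fun j => P j + P' j); first exact: is_splineD.
  by move=> j x jk xI xj; rewrite hornerD -(Pf j x) // -(Pg j x).
- exists (fun j => c *: P j); first exact: is_splineZ.
  by move=> j x jk xI xj; rewrite hornerZ -(Pf j x).
Qed.

Lemma piecewise_poly (p : {poly R}) : (size p <= m.+1)%N -> piecewise (horner p).
Proof.
by move=> sp; exists (fun=> p) => //; split=> // j _; rewrite subrr /full_contact dvdp0.
Qed.

Lemma piecewise_ext f g : (forall x, on_interval x -> f x = g x) ->
  piecewise f -> piecewise g.
Proof.
by move=> fg [P sP Pf]; exists P => // j x jk xI xj; rewrite -fg // (Pf j x).
Qed.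

Lemma piecewise_knot_function j s : (s < mu j)%N -> piecewise (knot_function j s).
Proof.
move=> sj; have [S0 SD SZ] := piecewise_closed; have mj := hmu j.
case: (leP j 0) => j0.
  apply: (piecewise_ext (f := fun=> 0)) => // x /andP[x0 _].
  by rewrite knot_function_left // (le_trans _ x0) // t_le.
pose q : {poly R} := (m ^_ s)%:R *: ((t j)%:P - 'X) ^+ (m - s).
have sq : (size q <= m.+1)%N.
  rewrite (leq_trans (size_scale_leq _ _)) // -opprB exprNn.
  by rewrite -signr_odd mulr_sign; case: ifP => _; rewrite ?size_polyN size_exp_XsubC; lia.
have qE x : x <= t j -> knot_function j s x = q.[x].
  move=> xj; rewrite knot_functionE // truncated_power_ge // /q.
  by rewrite !hornerE.
case: (leP k%:Z j) => kj.
  apply: (piecewise_ext _ (piecewise_poly sq)) => x /andP[_ xk].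
  by rewrite qE // (le_trans xk) // t_le.
have jE : j = `|j|%N%:Z by lia.
have jk : (0 < `|j| < k)%N by lia.
exists (fun i => if (i < `|j|)%N then q else 0).
  split=> [i _|i ik]; first by case: ifP; rewrite ?size_poly0.
  case: (ltngtP i `|j|%N) => ij.
  - by rewrite (_ : (i.-1 < _)%N) ?subrr /full_contact ?dvdp0 //; lia.
  - by rewrite (_ : (i.-1 < _)%N = false) ?subrr /full_contact ?dvdp0 //; lia.
  rewrite (_ : (i.-1 < _)%N) ?sub0r; last lia.
  rewrite /full_contact dvdpNr ij ext_knotE // ext_multE // -jE /q -mul_polyC dvdp_mull //.
  rewrite -(opprB 'X) exprNn dvdp_mull // dvdp_exp2l //; lia.
move=> i x ik xI /andP[ix xi]; case: ltnP => ij.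
  apply: qE; apply: le_trans xi _; rewrite jE -ext_knotE //.
  by apply: (knot_le ext_knot_lt); lia.
rewrite horner0 knot_function_left // (le_trans _ ix) // jE -ext_knotE //.
by apply: (knot_le ext_knot_lt); lia.
Qed.

Theorem in_spline_space_piecewise g : in_spline_space g -> piecewise g.
Proof.
move/in_spline_spaceP => [c gE].
apply: (piecewise_ext (f := spline_sum c)) => [x xI|]; first by rewrite gE.
have lS := piecewise_closed; have [S0 SD SZ] := lS.
apply: lin_closed_sum => // i _.
rewrite (_ : (fun x => _) = (fun x => \sum_(1 <= l < (mu i).+1 | (1 <= l < (mu i).+1)%N)
    c i l * Q i l x)); last by apply/funext => x; exact: big_nat.
apply: lin_closed_sum => // l Hl; apply: (SZ).
by apply: Q_mem => // j s _; apply: piecewise_knot_function.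
Qed.

Lemma in_spline_space_poly (p : {poly R}) : (size p <= m.+1)%N ->
  in_spline_space (horner p).
Proof.
apply: (@polynomials_of_powers R m (fun q => t (k + q)%N%:Z)).
- exact: in_spline_space_closed.
- by move=> a b /t_inj [] /addnI.
move=> q; have m0 : (0 < mu (k + q)%N%:Z)%N by case/andP: (hmu (k + q)%N%:Z).
apply: in_spline_space_ext (in_spline_space_knot_function m0) => //.
move=> x /andP[_ xk]; rewrite knot_functionE // ffactn0 mul1r subn0.
by rewrite truncated_power_ge // (le_trans xk) // t_le; lia.
Qed.

(** A polynomial with full contact at t j is a combination of (x - t j)^(m - s) with
    s < mu j, and cutting it off at t j turns these into knot functions. *)
Lemma in_spline_space_jump j (p : {poly R}) : (0 < j < k)%N -> (size p <= m.+1)%N ->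
  contact j p -> in_spline_space (fun x => if x < t j%:Z then p.[x] else 0).
Proof.
move=> jk sp; rewrite /full_contact ext_knotE // ext_multE // => /dvdpP[w pE].
have mj := hmu j%:Z; set e := (m.+1 - mu j%:Z)%N in pE.
have lS := in_spline_space_closed; have [S0 SD SZ] := lS.
have sw : (size w <= mu j%:Z)%N.
  have [->|w0] := eqVneq w 0; first by rewrite size_poly0.
  move: sp; rewrite pE size_Mmonic ?monic_exp ?monicXsubC // size_exp_XsubC /e.
  by move: (size w) (mu j%:Z) mj => z M; lia.
pose w' := w \Po ('X + (t j%:Z)%:P).
have sw' : (size w' <= mu j%:Z)%N by rewrite size_comp_poly2 // size_XaddC.
have wE x : w.[x] = \sum_(i < mu j%:Z) w'`_i * (x - t j%:Z) ^+ i.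
  rewrite -(horner_coef_wide _ sw') horner_comp !hornerE; congr (w.[_]).
  by rewrite subrK.
pose a i : R := (-1) ^+ (e + i) / (m ^_ (mu j%:Z - i.+1))%:R.
rewrite (_ : (fun x => _) = (fun x => \sum_(i <- enum 'I_(mu j%:Z))
    w'`_i * (a i * knot_function j%:Z (mu j%:Z - i.+1) x))).
  apply: lin_closed_sum => // i _; apply: (SZ); apply: (SZ).
  by apply: in_spline_space_knot_function => //; have := ltn_ord i; lia.
apply/funext => x; rewrite big_enum /=; case: ltP => xj.
  rewrite pE hornerM wE horner_exp hornerXsubC mulr_suml; apply: eq_bigr => i _.
  have im := ltn_ord i; rewrite knot_functionE; last lia.
  rewrite truncated_power_ge ?ltW // /a -mulrA; congr (_ * _).
  have -> : (m - (mu j%:Z - i.+1) = e + i)%N by rewrite /e; lia.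
  rewrite mulrA divfK ?pnatr_eq0 -?lt0n ?ffact_gt0; last lia.
  by rewrite -exprMn mulN1r opprB -exprD addnC.
rewrite big1 // => i _; have im := ltn_ord i.
by rewrite knot_function_left ?mulr0 //; lia.
Qed.

(** Telescoping: the spline is its last piece plus, for each interior knot, the
    jump there, cut off to the right of that knot. *)
Theorem spline_realized P : is_spline P -> exists2 g, in_spline_space g & agrees P g.
Proof.
move=> [sP dP]; have [S0 SD SZ] := in_spline_space_closed.
pose h x := (P k.-1).[x] +
  \sum_(1 <= j < k | (1 <= j < k)%N) (if x < t j%:Z then (P j.-1 - P j).[x] else 0).
have Sh : in_spline_space h.
  apply: SD; first by apply: in_spline_space_poly; apply: sP; lia.
  apply: lin_closed_sum => [|j jk]; first exact: in_spline_space_closed.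
  apply: in_spline_space_jump => //.
    by rewrite (leq_trans (size_polyD _ _)) // geq_max size_polyN !sP //; lia.
  by rewrite /full_contact -(opprB (P j)) dvdpNr; apply: dP.
exists h => // i x ik xI /andP[ix xi].
rewrite /h -big_nat (big_cat_nat (n := i.+1)) //=.
rewrite big_nat_cond big1 ?add0r => [|j /andP[Hj _]]; last first.
  rewrite ltNge (_ : t j%:Z <= x) // (le_trans _ ix) // -ext_knotE; last lia.
  by apply: (knot_le ext_knot_lt); lia.
rewrite (eq_big_nat _ _ (F2 := fun j => - (P j).[x] - - (P j.-1).[x])) => [|j Hj].
  rewrite big_add1 /= telescope_sumr; last lia.
  by ring.
have jk : (0 < j < k)%N by lia.
have xj : x <= t j%:Z by rewrite -ext_knotE // (le_trans xi) // (knot_le ext_knot_lt) //; lia.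
move: xj; rewrite le_eqVlt => /orP[/eqP xj|xj]; last by rewrite xj hornerD hornerN opprK addrC.
have := contact_root hk ext_mult0 ext_multk ext_multP jk (dP _ jk).
rewrite ext_knotE // /root hornerD hornerN subr_eq0 => /eqP e.
by rewrite xj ltxx e opprK addNr.
Qed.

(** * The four conditions as one *)
Section Conditions.
Variable E : seq R.
Hypothesis hE : uniq E.
Hypothesis hEsub : forall x, x \in E -> t 0 <= x <= t k.

Lemma ext_samples_required a b : (a < b <= k)%N ->
  samples_required rho a b = (rho a + rho b - 1 + \sum_(a.+1 <= l < b) 2 * mu l)%N.
Proof.
move=> /andP[ab bk]; congr (_ + _)%N; apply: eq_big_nat => l Hl.
by rewrite ext_multE //; lia.
Qed.

(** Including or excluding an end point of the interval costs at most one sample. *)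
Lemma count_except (p q : pred R) (x0 : R) :
  {in E, forall x, p x -> q x || (x == x0)} -> (count p E <= count q E + 1)%N.
Proof.
move=> H; apply: leq_trans (_ : count (predU q (pred1 x0)) E <= _)%N.
  rewrite -!size_filter; apply: uniq_leq_size; first exact: filter_uniq.
  by move=> x; rewrite !mem_filter => /andP[px xE]; rewrite xE andbT /= H.
rewrite -(leq_add2r (count (predI q (pred1 x0)) E)) count_predUI.
by rewrite (count_uniq_mem x0 hE) -addnA leq_add2l; case: (x0 \in E).
Qed.

Lemma ext_lower x : x \in E -> T 0 < x.
Proof. by move=> /hEsub /on_interval_ext /andP[]. Qed.

Lemma ext_upper x : x \in E -> x < T k.
Proof. by move=> /hEsub /on_interval_ext /andP[]. Qed.

(** The inequality for two knots, one of which is an end of the interval, follows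
    from the sharper one-sided inequalities, because mu is at most m. *)
Lemma sampling_conditionsP :
  [/\ (2 * m + 1 + \sum_(1 <= l < k) 2 * mu l <= size E)%N,
      (forall n : nat, (1 <= n <= k)%N ->
        (m + mu n + \sum_(1 <= l < n) 2 * mu l
         <= count (fun x => (t 0 <= x < t n)%R) E)%N),
      (forall n : nat, (n <= k - 1)%N ->
        (m + mu n + \sum_(n.+1 <= l < k) 2 * mu l
         <= count (fun x => (t n < x <= t k)%R) E)%N) &
      (forall n1 n2 : nat, (n1 < n2 <= k)%N ->
        (mu n1 + mu n2 - 1 + \sum_(n1.+1 <= l < n2) 2 * mu l
         <= count (fun x => (t n1 < x < t n2)%R) E)%N)]
  <-> enough_samples k T rho E.
Proof.
have lower x : x \in E -> t 0 <= x by move=> /hEsub /andP[].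
have upper x : x \in E -> x <= t k by move=> /hEsub /andP[].
have r0 : rho 0 = m.+1 by [].
have rk : rho k = m.+1 by rewrite /ext_mult eqxx orbT.
have rj j : (0 < j < k)%N -> rho j = mu j by move=> Hj; rewrite ext_multE.
have Tj j : (0 < j < k)%N -> T j = t j by move=> Hj; rewrite ext_knotE.
have call : count_in E (T 0) (T k) = size E.
  apply/eqP; rewrite -all_count; apply/allP => x xE.
  by rewrite /= ext_lower // ext_upper.
have cl n : (0 < n < k)%N ->
    count_in E (T 0) (T n) = count (fun x => (t 0 <= x < t n)%R) E.
  by move=> Hn; apply: eq_in_count => x xE; rewrite ext_lower // lower // Tj.
have cr n : (0 < n < k)%N ->
    count_in E (T n) (T k) = count (fun x => (t n < x <= t k)%R) E.
  by move=> Hn; apply: eq_in_count => x xE; rewrite ext_upper // upper // Tj.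
have cm n1 n2 : (0 < n1)%N -> (n1 < n2)%N -> (n2 < k)%N ->
    count_in E (T n1) (T n2) = count (fun x => (t n1 < x < t n2)%R) E.
  by move=> h1 h12 h2; rewrite /count_in !Tj //; lia.
split=> [[c1 c2 c3 c4] a b abk|dE].
  have /andP[ab bk] := abk; rewrite ext_samples_required //.
  have [a0|a0] := posnP a; have [bk'|bk'] := eqVneq b k.
  - rewrite a0 bk' r0 rk call; apply: leq_trans c1; lia.
  - have Hb : (0 < b < k)%N by lia.
    rewrite a0 r0 rj // cl //; apply: leq_trans (c2 b _); lia.
  - have Ha : (0 < a < k)%N by lia.
    rewrite bk' rk rj // cr //; apply: leq_trans (c3 a _); lia.
  - by rewrite !rj ?cm //; [apply: c4 | lia..].
have D a b : (a < b <= k)%N ->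
  (rho a + rho b - 1 + \sum_(a.+1 <= l < b) 2 * mu l <= count_in E (T a) (T b))%N.
  by move=> ab; rewrite -ext_samples_required //; apply: dE.
have Dk : (2 * m + 1 + \sum_(1 <= l < k) 2 * mu l <= size E)%N.
  by have := D 0%N k; rewrite r0 rk call => H; apply: leq_trans (H _); lia.
have D0 n : (0 < n < k)%N -> (m + mu n + \sum_(1 <= l < n) 2 * mu l
    <= count (fun x => (t 0 <= x < t n)%R) E)%N.
  by move=> Hn; rewrite -cl //; have := D 0%N n; rewrite r0 rj // => H;
    apply: leq_trans (H _); lia.
have D1 n : (0 < n < k)%N -> (m + mu n + \sum_(n.+1 <= l < k) 2 * mu l
    <= count (fun x => (t n < x <= t k)%R) E)%N.
  move=> Hn; rewrite -cr //; have := D n k; rewrite rk rj // => H.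
  by apply: leq_trans (H _); lia.
have c0k : (size E <= count (fun x => (t 0 <= x < t k)%R) E + 1)%N.
  rewrite -(count_predT E); apply: (@count_except _ _ (t k)) => x xE _.
  by rewrite lower //= lt_neqAle upper // andbT orNb.
have c0k' : (size E <= count (fun x => (t 0 < x <= t k)%R) E + 1)%N.
  rewrite -(count_predT E); apply: (@count_except _ _ (t 0)) => x xE _.
  by rewrite upper // andbT lt_neqAle lower // andbT eq_sym orNb.
have cr0 n : (count (fun x => (t 0 <= x < t n)%R) E
    <= count (fun x => (t 0 < x < t n)%R) E + 1)%N.
  apply: (@count_except _ _ (t 0)) => x xE /andP[x0 ->].
  by rewrite andbT lt_neqAle x0 andbT eq_sym orNb.
have crk n : (count (fun x => (t n < x <= t k)%R) E
    <= count (fun x => (t n < x < t k)%R) E + 1)%N.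
  apply: (@count_except _ _ (t k)) => x xE /andP[-> xk].
  by rewrite lt_neqAle xk andbT orNb.
split=> // [n Hn|n Hn|n1 n2 /andP[n12 n2k]].
- have [->|nk] := eqVneq n k; last by apply: D0; lia.
  by rewrite -(leq_add2r 1); apply: leq_trans c0k; have := hmu k; lia.
- have [->|n0] := posnP n; last by apply: D1; lia.
  by rewrite -(leq_add2r 1); apply: leq_trans c0k'; have := hmu 0%N; lia.
have [->|n10] := posnP n1; have [n2E|n2k'] := eqVneq n2 k.
- rewrite n2E -(leq_add2r 1); apply: leq_trans (cr0 k); rewrite -(leq_add2r 1).
  by apply: leq_trans c0k; have := hmu 0%N; have := hmu k; lia.
- rewrite -(leq_add2r 1); apply: leq_trans (cr0 n2).
  by apply: leq_trans (D0 n2 _); have := hmu 0%N; have := hmu n2; lia.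
- rewrite n2E -(leq_add2r 1); apply: leq_trans (crk n1).
  by apply: leq_trans (D1 n1 _); have := hmu n1; have := hmu k; lia.
have H : (n1 < n2 <= k)%N by lia.
by have := D _ _ H; rewrite cm ?rj //; lia.
Qed.

End Conditions.

(** * Phaseless sampling *)

Local Notation A := `[t 0, t k]%classic.
Local Notation H := (spline_space_on m t mu (t 0) (t k)).
Implicit Types (f g : A -> R) (P : nat -> {poly R}).

Definition agrees_on P f := forall j (x : A), (j < k)%N ->
  T j <= set_val x <= T j.+1 -> f x = (P j).[set_val x].

Lemma on_interval_val (x : A) : on_interval (set_val x).
Proof. by have := set_valP x; rewrite /= in_itv. Qed.

Lemma restriction_agrees f : H f -> exists2 P, is_spline P & agrees_on P f.
Proof.
move=> [F SF <-]; have [|P sP PF] := @in_spline_space_piecewise F.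
  by exists F.
by exists P => // j x jk xj; rewrite /sigL /= (PF j) //; apply: on_interval_val.
Qed.

Lemma spline_restriction P : is_spline P -> exists2 f, H f & agrees_on P f.
Proof.
move=> /spline_realized [g [F SF Fg] Pg].
exists (sigL A F); first by exists F.
move=> j x jk xj; have xI := on_interval_val x.
by rewrite /sigL /= Fg // (Pg j).
Qed.

Lemma agrees_on_inj P f g : agrees_on P f -> agrees_on P g -> f = g.
Proof.
move=> Pf Pg; apply/funext => x.
have [j jk xj] := piece_exists (on_interval_val x).
by rewrite (Pf j) // (Pg j).
Qed.

Lemma agrees_on_poly j P P' f : (j < k)%N -> agrees_on P f -> agrees_on P' f -> P j = P' j.
Proof.
move=> jk Pf P'f; apply/eqP; rewrite -subr_eq0; apply/eqP.
have tj : t j < t j.+1 by apply: (t_lt); lia.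
apply: (poly0_on_interval tj) => x xj; have [xI xT] := piece_points jk xj.
have xA : x \in A by rewrite inE /= in_itv.
by rewrite hornerD hornerN -(Pf j (SigSub xA)) // -(P'f j (SigSub xA)) // subrr.
Qed.

Lemma agrees_on0 : agrees_on (fun=> 0) (cst 0).
Proof. by move=> j x _ _; rewrite horner0. Qed.

Lemma agrees_onD P P' f g : agrees_on P f -> agrees_on P' g ->
  agrees_on (fun j => P j + P' j) (fun x => f x + g x).
Proof. by move=> Pf Pg j x jk xj; rewrite hornerD -(Pf j x) // -(Pg j x). Qed.

Lemma agrees_onZ c P f : agrees_on P f ->
  agrees_on (fun j => c *: P j) (fun x => c * f x).
Proof. by move=> Pf j x jk xj; rewrite hornerZ -(Pf j x). Qed.

Lemma spline_space_onP f P : is_spline P -> agrees_on P f -> H f.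
Proof. by move=> /spline_restriction[g Hg Pg] /(agrees_on_inj Pg) <-. Qed.

Lemma agrees_on_neq0 f P : agrees_on P f -> (exists2 j, (j < k)%N & P j != 0) <-> f <> cst 0.
Proof.
move=> Pf; split=> [[j jk Pj] f0|f0].
  by move: Pj; rewrite (agrees_on_poly jk Pf (P' := fun=> 0)) ?eqxx // f0; apply: agrees_on0.
apply/not_exists2P; apply: contra_not f0 => H0.
apply: (agrees_on_inj Pf) => j x jk _.
by have [//|/negP/negPn/eqP ->] := H0 j; rewrite horner0.
Qed.

(** In a decomposition f = f1 + f2 with f1 f2 = 0, exactly one of f1, f2 is nonzero on
    each piece. A change from one to the other at a knot would give f full contact
    there, so the same one vanishes on all pieces. *)
Theorem contact_free_nonseparable f P : is_spline P -> agrees_on P f ->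
  (forall j, (0 < j < k)%N -> ~~ contact j (P j)) -> nonseparable H f.
Proof.
move=> sP Pf nc [f1 [f2 [[H1 n1] [H2 n2] fE f12]]].
have [A1 s1 a1] := restriction_agrees H1; have [A2 s2 a2] := restriction_agrees H2.
have PE j : (j < k)%N -> P j = A1 j + A2 j.
  move=> jk; apply: (agrees_on_poly (P' := fun j => A1 j + A2 j) jk Pf).
  have -> : f = fun x => f1 x + f2 x by apply/funext.
  exact: agrees_onD.
have A12 j : (j < k)%N -> A1 j = 0 \/ A2 j = 0.
  move=> jk; have : A1 j * A2 j = 0.
    have tj : t j < t j.+1 by apply: (t_lt); lia.
    apply: (poly0_on_interval tj) => x xj; have [xI xT] := piece_points jk xj.
    have xA : x \in A by rewrite inE /= in_itv.
    by rewrite hornerM -(a1 j (SigSub xA)) // -(a2 j (SigSub xA)).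
  by move=> /eqP; rewrite mulf_eq0 => /orP[]/eqP; [left|right].
have step j : (0 < j < k)%N -> (A1 j.-1 == 0) = (A1 j == 0).
  move=> jk; have := nc j jk; have [jk1 jk2] : (j < k)%N /\ (j.-1 < k)%N by lia.
  have d1 := s1.2 j jk; have d2 := s2.2 j jk; rewrite PE //.
  have [z1|nz1] := eqVneq (A1 j.-1) 0; have [z2|nz2] := eqVneq (A1 j) 0 => //.
    have A20 : A2 j = 0 by case: (A12 j jk1) => // z; rewrite z eqxx in nz2.
    by rewrite A20 addr0; move: d1; rewrite z1 subr0 => ->.
  have A20 : A2 j.-1 = 0 by case: (A12 j.-1 jk2) => // z; rewrite z eqxx in nz1.
  by rewrite z2 add0r; move: d2; rewrite A20 subr0 => ->.
have all0 j : (j < k)%N -> (A1 j == 0) = (A1 0%N == 0).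
  by elim: j => // j IHj jk; rewrite -(step j.+1) //= IHj // ltnW.
have [i1 i1k nz1] := (agrees_on_neq0 a1).2 n1.
have [i2 i2k nz2] := (agrees_on_neq0 a2).2 n2.
have : A1 i2 == 0 by case: (A12 i2 i2k) => [->|z] //; rewrite z eqxx in nz2.
by rewrite all0 // -(all0 i1) // (negbTE nz1).
Qed.

Section Sampling.
Variable E : seq R.
Hypothesis hE : uniq E.
Hypothesis hEsub : forall x, x \in E -> t 0 <= x <= t k.

Theorem enough_samples_phaseless : enough_samples k T rho E -> phaseless_sampling_sequence H E.
Proof.
move=> dE; split=> [x /hEsub xA|f g Hf nf Hg fg]; first by rewrite /= in_itv.
have [P sP Pf] := restriction_agrees Hf; have [P' sP' Pg] := restriction_agrees Hg.
pose S j := P j + P' j; pose D j := P j + (-1) *: P' j.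
have sS : is_spline S by apply: is_splineD.
have sD : is_spline D by apply: is_splineD => //; apply: is_splineZ.
have aS : agrees_on S (fun x => f x + g x) by apply: agrees_onD.
have aD : agrees_on D (fun x => f x + -1 * g x).
  by apply: agrees_onD => //; apply: agrees_onZ.
pose at_ (h : A -> R) (x : R) : R := if pselect (x \in A) is left xA then h (SigSub xA) else 0.
have rk : rho k = m.+1 by rewrite /ext_mult eqxx orbT.
have prod0 : forall j, (j < k)%N -> S j = 0 \/ D j = 0.
  apply (@enough_samples_product0 R m k T rho hk ext_knot_lt erefl rk ext_multP E S D
    (at_ (fun x => f x + g x)) (at_ (fun x => f x + -1 * g x))) => //.
  - move=> j jk x xE xj; have xA : x \in A by rewrite inE /= in_itv /= hEsub.
    by rewrite /at_; case: pselect => // xA'; rewrite (aS j) // (aD j).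
  move=> x xE; have xA : x \in A by rewrite inE /= in_itv /= hEsub.
  rewrite /at_; case: pselect => // xA'; have := fg (SigSub xA') xE.
  move=> /(congr1 (fun z => z ^+ 2)); rewrite !real_normK ?num_real // => e.
  by transitivity (f (SigSub xA') ^+ 2 - g (SigSub xA') ^+ 2); [ring | rewrite e subrr].
have [/(agrees_on_neq0 aS) nS|/forall2NP zS] :=
  pselect (exists2 j, (j < k)%N & S j != 0); last first.
  right=> x; have [j jk xj] := piece_exists (on_interval_val x).
  have := aS j x jk xj; have [//|/negP/negPn/eqP ->] := zS j.
  by rewrite horner0 => /eqP; rewrite addrC addr_eq0 => /eqP.
have [/(agrees_on_neq0 aD) nD|/forall2NP zD] :=
  pselect (exists2 j, (j < k)%N & D j != 0); last first.
  left=> x; have [j jk xj] := piece_exists (on_interval_val x).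
  have := aD j x jk xj; have [//|/negP/negPn/eqP ->] := zD j.
  by rewrite horner0 mulN1r => /eqP; rewrite subr_eq0 => /eqP.
case: nf; exists (fun x => 2^-1 * (f x + g x)), (fun x => 2^-1 * (f x + -1 * g x)).
have half (h : A -> R) : h <> cst 0 -> (fun x => 2^-1 * h x) <> cst 0.
  move=> nh; apply: contra_not nh => h0; apply/funext => x.
  by have := congr1 (fun u => 2 * u x) h0; rewrite /cst mulr0 mulVKf.
split.
- by split; [apply: spline_space_onP (is_splineZ 2^-1 sS) (agrees_onZ _ aS) | apply: half].
- by split; [apply: spline_space_onP (is_splineZ 2^-1 sD) (agrees_onZ _ aD) | apply: half].
- by move=> x; lra.
move=> x; have [j jk xj] := piece_exists (on_interval_val x).
rewrite (aS j x jk xj) (aD j x jk xj).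
by case: (prod0 j jk) => ->; rewrite horner0 !(mulr0, mul0r).
Qed.

Theorem phaseless_enough_samples : phaseless_sampling_sequence H E -> enough_samples k T rho E.
Proof.
move=> [_ ps] a b abk; rewrite leqNgt; apply/negP => gap.
have Ein : {in E, forall x, T 0 < x < T k}.
  by move=> x /hEsub /on_interval_ext.
have rk : rho k = m.+1 by rewrite /ext_mult eqxx orbT.
have [P [Q [[sP sQ] nP nQ PQ nc]]] :=
  @gap_witness R m k T rho hk ext_knot_lt erefl rk ext_multP E a b hE Ein abk gap.
have [c c0 Hc] := contact_free_combination sP sQ nc.
have [u Hu Pu] := spline_restriction sP.
have [v Hv Qv] := spline_restriction (is_splineZ c sQ).
have aD : agrees_on (fun j => P j + c *: Q j) (fun x => u x + v x) by apply: agrees_onD.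
have aB : agrees_on (fun j => P j + (-1) *: (c *: Q j)) (fun x => u x + -1 * v x).
  by apply: agrees_onD => //; apply: agrees_onZ.
have sD : is_spline (fun j => P j + c *: Q j) by apply: is_splineD => //; apply: is_splineZ.
have sB : is_spline (fun j => P j + (-1) *: (c *: Q j)).
  by apply: is_splineD => //; do 2!apply: is_splineZ.
have u0 : u <> cst 0 by apply/(agrees_on_neq0 Pu).
have v0 : v <> cst 0.
  apply/(agrees_on_neq0 Qv); have [j jk Qj] := nQ.
  by exists j => //; rewrite scaler_eq0 negb_or c0.
have uv0 (x : A) : set_val x \in E -> u x * v x = 0.
  move=> xE; have [j jk xj] := piece_exists (on_interval_val x).
  rewrite (Pu j x jk xj) (Qv j x jk xj) hornerZ.
  by case/orP: (PQ _ xE j jk xj) => /eqP ->; rewrite !(mulr0, mul0r).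
have [|||x xE|e|e] := ps (fun x => u x + v x) (fun x => u x + -1 * v x).
- exact: spline_space_onP sD aD.
- exact: contact_free_nonseparable sD aD Hc.
- exact: spline_space_onP sB aB.
- have /eqP := uv0 x xE; rewrite mulf_eq0 => /orP[]/eqP ->.
    by rewrite !add0r mulN1r normrN.
  by rewrite mulr0.
- by apply: v0; apply/funext => x; have := e x; rewrite /cst; lra.
- by apply: u0; apply/funext => x; have := e x; rewrite /cst; lra.
Qed.

End Sampling.
End SplinesOnInterval.

Theorem theorem2p7 (R : realType) (m k : nat) (t : int -> R) (mu : int -> nat)
    (hm : (1 <= m)%N) (hk : (1 <= k)%N)
    (ht : forall i : int, t i < t (i + 1))
    (hmu : forall i : int, (1 <= mu i <= m)%N)
    (E : seq R) (hE : uniq E)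
    (hEsub : forall x, x \in E -> t 0 <= x <= t k) :
  phaseless_sampling_sequence
    (spline_space_on m t mu (t 0) (t k)) E
  <->
  [/\ (2 * m + 1 + \sum_(1 <= l < k) 2 * mu l <= size E)%N,
      (forall n : nat, (1 <= n <= k)%N ->
        (m + mu n + \sum_(1 <= l < n) 2 * mu l
         <= count (fun x => (t 0 <= x < t n)%R) E)%N),
      (forall n : nat, (n <= k - 1)%N ->
        (m + mu n + \sum_(n.+1 <= l < k) 2 * mu l
         <= count (fun x => (t n < x <= t k)%R) E)%N) &
      (forall n1 n2 : nat, (n1 < n2 <= k)%N ->
        (mu n1 + mu n2 - 1 + \sum_(n1.+1 <= l < n2) 2 * mu l
         <= count (fun x => (t n1 < x < t n2)%R) E)%N)].
Proof.
rewrite (sampling_conditionsP hm hk hmu hE hEsub); split.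
  exact: phaseless_enough_samples.
exact: enough_samples_phaseless.
Qed.
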